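(* Let $f:(\mathbb{R}^2,0)\to(\mathbb{R}^3,0)$ be a $C^\infty$ map-germ. Assume there is a local coordinate system $(u,v)$ centred at $0$ and smooth $\mathbb{R}^3$-valued germs $\phi_1,\phi_2$ such that $f_u=u\,\phi_1(u,v)$, $f_v=v\,\phi_2(u,v)$, and $\phi_1(0,0),\phi_2(0,0)$ are linearly independent. Then there exist a real number $a$, smooth function germs $b_1,b_3,c_1,c_3$ of one variable at $0$, smooth function germs $b_2,c_2$ of two variables at $0$, a germ $s$ of an orientation-preserving diffeomorphism of $(\mathbb{R}^2,0)$ and $A\in SO(3)$ such that $$A\circ f\circ s^{-1}(u,v)=\Big(u^2-v^2,\ a(u^2+v^2)+u^3b_1(u)+u^2v^2b_2(u,v)+v^3b_3(v),\ u^3c_1(u)+u^2v^2c_2(u,v)+v^3c_3(v)\Big),$$ with $a\ge 0$, $c_1(0)\ge 0$ and $c_3(0)\ge 0$.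
   Context: A map-germ $(\mathbb{R}^n,0)\to(\mathbb{R}^m,0)$ means a germ at $0$ of a smooth map sending $0$ to $0$. $SO(3)$ acts on $\mathbb{R}^3$ by rotations. *)

(* Defs.v *)
From HB Require Import structures.
From mathcomp Require Import all_boot all_order all_algebra.
From mathcomp Require Import all_classical all_reals topology normedtype derive.
Set Implicit Arguments. Unset Strict Implicit. Unset Printing Implicit Defensive.
Import Order.TTheory GRing.Theory Num.Theory.
Import numFieldNormedType.Exports.
Local Open Scope ring_scope.
Local Open Scope classical_set_scope.

Section Defs.
Variable R : realType.

Definition pu (f : R -> R -> R) (u v : R) : R := derive1 (fun x => f x v) u.
Definition pv (f : R -> R -> R) (u v : R) : R := derive1 (fun y => f u y) v.

Fixpoint C2k (n : nat) (U : set (R * R)) (f : R -> R -> R) : Prop :=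
  match n with
  | 0 => forall p, U p -> {for p, continuous (fun q : R * R => f q.1 q.2)}
  | n'.+1 =>
      (forall p, U p -> derivable (fun x => f x p.2) p.1 1
                     /\ derivable (fun y => f p.1 y) p.2 1)
      /\ C2k n' U (pu f) /\ C2k n' U (pv f)
  end.

Fixpoint C1k (n : nat) (U : set R) (g : R -> R) : Prop :=
  match n with
  | 0 => forall x, U x -> {for x, continuous g}
  | n'.+1 => (forall x, U x -> derivable g x 1) /\ C1k n' U (derive1 g)
  end.

Definition sq (e : R) : set (R * R) := [set p | `|p.1| < e /\ `|p.2| < e].
Definition itv0 (e : R) : set R := [set x | `|x| < e].

Definition smooth2_germ (f : R -> R -> R) : Prop :=
  exists2 e : R, 0 < e & forall n, C2k n (sq e) f.
Definition smooth1_germ (g : R -> R) : Prop :=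
  exists2 e : R, 0 < e & forall n, C1k n (itv0 e) g.

Definition diffeo_germ (s1 s2 t1 t2 : R -> R -> R) : Prop :=
  [/\ smooth2_germ s1 /\ smooth2_germ s2,
      smooth2_germ t1 /\ smooth2_germ t2,
      (s1 0 0 = 0 /\ s2 0 0 = 0) /\ (t1 0 0 = 0 /\ t2 0 0 = 0),
      exists2 e : R, 0 < e & forall u v, sq e (u, v) ->
          t1 (s1 u v) (s2 u v) = u /\ t2 (s1 u v) (s2 u v) = v
    & exists2 e : R, 0 < e & forall u v, sq e (u, v) ->
          s1 (t1 u v) (t2 u v) = u /\ s2 (t1 u v) (t2 u v) = v].

Definition orient_pres (s1 s2 : R -> R -> R) : Prop :=
  0 < pu s1 0 0 * pv s2 0 0 - pv s1 0 0 * pu s2 0 0.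

Definition SO3 (A : 'M[R]_3) : Prop := A *m A^T = 1%:M /\ \det A = 1.

End Defs.

(* Main.v *)
(** Along the axes of the given coordinates [(u, v)] the conditions [f_u = u phi1] and
    [f_v = v phi2] say that every component splits as
    [u^2 al(u) + v^2 be(v) + u^2 v^2 ch(u, v)].  A rotation sends the directions of
    [phi1(0) - phi2(0)] and [phi1(0) + phi2(0)], after normalising both vectors to
    length 1, to the first two basis vectors.  The first component then has
    [al(0) > 0 > be(0)], and replacing [u] by [u * sqrt (al(u) + v^2 ch(u, v))] turns it
    into [u^2 + v^2 be(v)].  The [v]-derivative of this substitution vanishes on [v = 0], so it
    preserves the splitting of the other two components; the same step with [u] and [v]
    exchanged gives [u^2 - v^2].  The symmetries of [u^2 - v^2], namely sign changes of [u] and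
    [v] and the exchange of [u] and [v] combined with the half-turn [diag(-1, 1, -1)], fix the
    orientation and the signs of [c1(0)] and [c3(0)].

    Smoothness of quotients is obtained without integrals: if [W_u = u^k f] and [W = 0] on
    [u = 0], the partial derivatives of [W / u^(k+1)] are again quotients of this kind, so
    induction on the order of differentiability applies. *)
Require Import Defs.
From HB Require Import structures.
From mathcomp Require Import all_boot all_order all_algebra.
From mathcomp Require Import all_classical all_reals topology normedtype derive.
From mathcomp Require Import realfun ring lra.
Import Order.TTheory GRing.Theory Num.Theory.
Import numFieldNormedType.Exports.
Local Open Scope ring_scope.
Local Open Scope classical_set_scope.

Set Implicit Arguments.
Unset Strict Implicit.

(** * Partial derivatives and the classes [C2k] *)

Section Analysis.
Variable R : realType.
Implicit Types (f g : R -> R -> R) (p q : R * R) (U V : set (R * R)).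

Lemma nbhs_boxP p (P : set (R * R)) :
  nbhs p P <-> exists2 e : R, 0 < e &
    forall q, `|q.1 - p.1| < e -> `|q.2 - p.2| < e -> P q.
Proof.
split.
  move/nbhs_ballP => [e /= e0 H]; exists e => // q q1 q2.
  by apply: H; split; rewrite /ball /= distrC.
move=> [e e0 H]; apply/nbhs_ballP; exists e => // q [].
by rewrite /ball /= => q1 q2; apply: H; rewrite distrC.
Qed.

Lemma nbhs_itvP (x : R) (P : set R) :
  nbhs x P <-> exists2 e : R, 0 < e & forall y, `|y - x| < e -> P y.
Proof.
split.
  move/nbhs_ballP => [e /= e0 H]; exists e => // y yx.
  by apply: H; rewrite /ball /= distrC.
move=> [e e0 H]; apply/nbhs_ballP; exists e => // y.
by rewrite /ball /= => yx; apply: H; rewrite distrC.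
Qed.

Lemma near_slice1 p (P : set (R * R)) : nbhs p P -> \forall x \near p.1, P (x, p.2).
Proof.
move=> /nbhs_boxP[e e0 H]; apply/nbhs_itvP; exists e => // y yx.
by apply: H => //=; rewrite subrr normr0.
Qed.

Lemma near_slice2 p (P : set (R * R)) : nbhs p P -> \forall y \near p.2, P (p.1, y).
Proof.
move=> /nbhs_boxP[e e0 H]; apply/nbhs_itvP; exists e => // y yx.
by apply: H => //=; rewrite subrr normr0.
Qed.

Lemma is_derive_puP f (u v l : R) :
  is_derive u 1 (fun x => f x v) l -> derivable (fun x => f x v) u 1 /\ pu f u v = l.
Proof. by move=> H; split; [exact: ex_derive|rewrite /pu derive1E derive_val]. Qed.

Lemma is_derive_pvP f (u v l : R) :
  is_derive v 1 (fun y => f u y) l -> derivable (fun y => f u y) v 1 /\ pv f u v = l.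
Proof. by move=> H; split; [exact: ex_derive|rewrite /pv derive1E derive_val]. Qed.

Lemma derivable_pu {f} {u v : R} :
  derivable (fun x => f x v) u 1 -> is_derive u 1 (fun x => f x v) (pu f u v).
Proof. by move=> H; rewrite /pu derive1E; exact: derivableP. Qed.

Lemma derivable_pv {f} {u v : R} :
  derivable (fun y => f u y) v 1 -> is_derive v 1 (fun y => f u y) (pv f u v).
Proof. by move=> H; rewrite /pv derive1E; exact: derivableP. Qed.

(** Norm inequalities cover both orders of [x] and [y] at once. The clause [c != x] is kept because
    [divided_mvt] cancels a power of the intermediate point. *)
Lemma mvt (f df : R -> R) (x y : R) :
  (forall z, `|z - x| <= `|y - x| -> is_derive z 1 f (df z)) ->
  exists c, [/\ `|c - x| <= `|y - x|, (y != x -> c != x) & f y - f x = df c * (y - x)].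
Proof.
move=> H; have [xy|yx|->] := ltgtP x y; last first.
- by exists y; rewrite !subrr mulr0.
- have D z : z \in `[y, x]%R -> is_derive z 1 f (df z).
    rewrite in_itv /= => /andP[h1 h2]; apply: H.
    by rewrite !ler0_norm; lra.
  have Do z : z \in `]y, x[%R -> is_derive z 1 f (df z).
    by move=> zi; apply: D; exact: subset_itv_oo_cc zi.
  have Dc : {within `[y, x], continuous f}.
    by apply: derivable_within_continuous => z /D dz; exact: ex_derive.
  have [c ci E] := MVT yx Do Dc.
  move: ci; rewrite in_itv /= => /andP[h1 h2]; exists c; split; [|by rewrite lt_eqF|by lra].
  by rewrite !ler0_norm; lra.
- have D z : z \in `[x, y]%R -> is_derive z 1 f (df z).
    rewrite in_itv /= => /andP[h1 h2]; apply: H.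
    by rewrite !ger0_norm; lra.
  have Do z : z \in `]x, y[%R -> is_derive z 1 f (df z).
    by move=> zi; apply: D; exact: subset_itv_oo_cc zi.
  have Dc : {within `[x, y], continuous f}.
    by apply: derivable_within_continuous => z /D dz; exact: ex_derive.
  have [c ci E] := MVT xy Do Dc.
  move: ci; rewrite in_itv /= => /andP[h1 h2]; exists c; split; [|by rewrite gt_eqF|by []].
  by rewrite !ger0_norm; lra.
Qed.

(** * Differentiability through Caratheodory factorisations *)

Lemma is_derive_slope (f g : R -> R) (x : R) :
  (\forall z \near x, f z - f x = g z * (z - x)) -> {for x, continuous g} ->
  is_derive x 1 f (g x).
Proof.
move=> H gx; have fx : f x = f x + g x * (x - x) by rewrite subrr mulr0 addr0.
apply: (@near_eq_is_derive _ _ _ (fun z => f x + g z * (z - x))).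
  by apply: filterS H => z E; rewrite -E addrC subrK.
apply/is_derive1_caratheodory; exists g; split => // z.
by rewrite -fx addrC addKr.
Qed.

Lemma cvgP_box (F : R * R -> R) p : {for p, continuous F} <->
  forall e : R, 0 < e -> exists2 d : R, 0 < d &
    forall q, `|q.1 - p.1| < d -> `|q.2 - p.2| < d -> `|F q - F p| < e.
Proof.
split=> [H e e0|H].
  move/cvgrPdist_lt : H => /(_ e e0) /nbhs_boxP[d d0 H]; exists d => // q q1 q2.
  by rewrite distrC; exact: H.
apply/cvgrPdist_lt => e e0; apply/nbhs_boxP; have [d d0 D] := H e e0.
by exists d => // q q1 q2; rewrite distrC; exact: D.
Qed.

Lemma slope_continuous (f : R -> R) (x l : R) : is_derive x 1 f l ->
  {for x, continuous (fun y => if y == x then l else (f y - f x) / (y - x))}.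
Proof.
move=> /is_derive1_caratheodory[g [fg gx <-]].
have -> // : (fun y => if y == x then g x else (f y - f x) / (y - x)) = g.
apply/funext => y; case: eqP => [->//|/eqP yx].
by rewrite fg mulfK// subr_eq0.
Qed.

(** Total differentiability at [p] from continuity of one partial derivative and mere existence of
    the other: the increment is taken along the horizontal line through [q], then along the vertical
    line through [p]. [A] and [b] are the two difference quotients, completed by the derivatives at
    [p]. *)
Lemma caratheodory2 f p :
  (\forall q \near p, derivable (fun x => f x q.2) q.1 1) ->
  derivable (fun y => f p.1 y) p.2 1 ->
  {for p, continuous (fun q => pu f q.1 q.2)} ->
  exists A B : R * R -> R,
    [/\ {for p, continuous A}, {for p, continuous B},
        A p = pu f p.1 p.2, B p = pv f p.1 p.2 &
        forall q, f q.1 q.2 - f p.1 p.2 = A q * (q.1 - p.1) + B q * (q.2 - p.2)].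
Proof.
move=> /nbhs_boxP[e e0 D] dv cu.
pose A q := if q.1 == p.1 then pu f p.1 p.2 else (f q.1 q.2 - f p.1 q.2) / (q.1 - p.1).
pose b y := if y == p.2 then pv f p.1 p.2 else (f p.1 y - f p.1 p.2) / (y - p.2).
exists A, (b \o snd); split.
- apply/cvgP_box => eps eps0; move/cvgP_box : cu => /(_ eps eps0)[d d0 H].
  have m0 : 0 < Num.min e d by rewrite lt_min e0 d0.
  exists (Num.min e d) => // q; rewrite !lt_min => /andP[q1e q1d] /andP[q2e q2d].
  rewrite /A eqxx; case: eqP => [|/eqP qp]; first by rewrite subrr normr0.
  (* The quotient is a value of [pu f] on the same slice, at a point no farther from [p] than [q],
     so continuity of [pu f] at [p] applies. *)
  have [c [c1 _ ->]] := @mvt (fun x => f x q.2) (fun x => pu f x q.2) p.1 q.1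
    (fun z zp => derivable_pu (D (z, q.2) (le_lt_trans zp q1e) q2e)).
  rewrite mulfK ?subr_eq0//.
  by apply: (H (c, q.2)) => //=; exact: le_lt_trans q1d.
- apply: continuous_comp; first exact: cvg_snd.
  have := @slope_continuous _ _ _ (derivable_pv dv); exact.
- by rewrite /A eqxx.
- by rewrite /b /= eqxx.
- move=> q; have -> : f q.1 q.2 - f p.1 p.2 =
    (f q.1 q.2 - f p.1 q.2) + (f p.1 q.2 - f p.1 p.2) by ring.
  congr (_ + _).
    rewrite /A; case: eqP => [->|/eqP qp]; first by rewrite !subrr mulr0.
    by rewrite divfK// subr_eq0.
  rewrite /b /=; case: eqP => [->|/eqP qp]; first by rewrite !subrr mulr0.
  by rewrite divfK// subr_eq0.
Qed.

Lemma continuous_pair (T : topologicalType) (a b : T -> R) (t : T) :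
  {for t, continuous a} -> {for t, continuous b} ->
  {for t, continuous (fun t => (a t, b t))}.
Proof. by move=> ca cb; exact: (@cvg_pair _ _ _ _ (nbhs (a t)) (nbhs (b t))). Qed.

Lemma C2k_open_caratheodory U f p : open U -> C2k 1 U f -> U p ->
  exists A B : R * R -> R,
    [/\ {for p, continuous A}, {for p, continuous B},
        A p = pu f p.1 p.2, B p = pv f p.1 p.2 &
        forall q, f q.1 q.2 - f p.1 p.2 = A q * (q.1 - p.1) + B q * (q.2 - p.2)].
Proof.
move=> oU [D [cu cv]] Up; apply: caratheodory2.
- have : nbhs p U by exact: open_nbhs_nbhs.
  by apply: filterS => q /D[].
- by have [] := D _ Up.
- exact: cu.
Qed.

Lemma C2k1_continuous U f : open U -> C2k 1 U f -> C2k 0 U f.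
Proof.
move=> oU Cf p Up; have [A [B [cA cB _ _ E]]] := C2k_open_caratheodory oU Cf Up.
have -> : (fun q => f q.1 q.2) =
   (fun q => f p.1 p.2 + (A q * (q.1 - p.1) + B q * (q.2 - p.2))).
  by apply/funext => q; rewrite -E addrC subrK.
have c1 : {for p, continuous (fun q : R * R => q.1 - p.1)}.
  by apply: cvgB; [exact: cvg_fst|exact: cvg_cst].
have c2 : {for p, continuous (fun q : R * R => q.2 - p.2)}.
  by apply: cvgB; [exact: cvg_snd|exact: cvg_cst].
by apply: cvgD; [exact: cvg_cst|apply: cvgD; apply: cvgM].
Qed.

(** * Inclusions and closure properties of the classes [C2k] *)

Lemma C2kW U n f : open U -> C2k n.+1 U f -> C2k n U f.
Proof.
move=> oU; elim: n f => [f|n IH f]; first exact: C2k1_continuous.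
by move=> [D [cu cv]]; split => //; split; apply: IH.
Qed.

Lemma eq_pu U f g p : open U -> (forall q, U q -> f q.1 q.2 = g q.1 q.2) -> U p ->
  pu f p.1 p.2 = pu g p.1 p.2.
Proof.
move=> oU E Up; rewrite /pu !derive1E; apply: near_eq_derive.
have /near_slice1 : nbhs p U by exact: open_nbhs_nbhs.
by apply: filterS => x /E.
Qed.

Lemma eq_pv U f g p : open U -> (forall q, U q -> f q.1 q.2 = g q.1 q.2) -> U p ->
  pv f p.1 p.2 = pv g p.1 p.2.
Proof.
move=> oU E Up; rewrite /pv !derive1E; apply: near_eq_derive.
have /near_slice2 : nbhs p U by exact: open_nbhs_nbhs.
by apply: filterS => x /E.
Qed.

Lemma eq_C2k U n f g : open U -> (forall q, U q -> f q.1 q.2 = g q.1 q.2) ->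
  C2k n U f -> C2k n U g.
Proof.
move=> oU; elim: n f g => [f g E H p Up|n IH f g E [D [cu cv]]].
  have cf : f q.1 q.2 @[q --> p] --> g p.1 p.2 by rewrite -E//; exact: H.
  apply: cvg_trans cf; apply: near_eq_cvg.
  have : nbhs p U by exact: open_nbhs_nbhs.
  by apply: filterS => x /E.
split.
  move=> p Up; have [d1 d2] := D _ Up.
  have nU : nbhs p U by exact: open_nbhs_nbhs.
  split; [apply: near_eq_derivable d1|apply: near_eq_derivable d2].
    by move: (near_slice1 nU); apply: filterS => x /E.
  by move: (near_slice2 nU); apply: filterS => x /E.
split; [apply: (IH (pu f)) cu|apply: (IH (pv f)) cv].
  by move=> q Uq; exact: (eq_pu oU).
by move=> q Uq; exact: (eq_pv oU).
Qed.

(** Allows the partial derivatives to be given by formulas valid only on [U]; this is the induction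
    step of most closure lemmas. *)
Lemma C2kS U n f a b : open U ->
  (forall p, U p -> is_derive p.1 1 (fun x => f x p.2) (a p.1 p.2) /\
                    is_derive p.2 1 (fun y => f p.1 y) (b p.1 p.2)) ->
  C2k n U a -> C2k n U b -> C2k n.+1 U f.
Proof.
move=> oU D ca cb; split; [|split].
- by move=> p /D[d1 d2]; split; exact: ex_derive.
- apply: (eq_C2k oU) ca => q /D[d1 _]; exact/esym/(is_derive_puP d1).2.
- apply: (eq_C2k oU) cb => q /D[_ d1]; exact/esym/(is_derive_pvP d1).2.
Qed.

Lemma C2k_sub U V n f : V `<=` U -> C2k n U f -> C2k n V f.
Proof.
move=> VU; elim: n f => [f H p /VU/H//|n IH f [D [cu cv]]].
by split; [move=> p /VU/D|split; exact: IH].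
Qed.

Lemma C2k_derive1 U n f p : C2k n.+1 U f -> U p ->
  is_derive p.1 1 (fun x => f x p.2) (pu f p.1 p.2).
Proof. by move=> [D _] /D[d _]; exact: derivable_pu. Qed.

Lemma C2k_derive2 U n f p : C2k n.+1 U f -> U p ->
  is_derive p.2 1 (fun y => f p.1 y) (pv f p.1 p.2).
Proof. by move=> [D _] /D[_ d]; exact: derivable_pv. Qed.

Lemma C2k_cst U n (c : R) : open U -> C2k n U (fun _ _ => c).
Proof.
move=> oU; elim: n c => [c p _|n IH c]; first exact: cvg_cst.
by apply: (C2kS oU (a := fun _ _ => 0) (b := fun _ _ => 0)) => // p _; split; exact: is_derive_cst.
Qed.

Lemma C2k_fst U n : open U -> C2k n U (fun x _ => x).
Proof.
move=> oU; case: n => [p _|n]; first exact: cvg_fst.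
apply: (C2kS oU (a := fun _ _ => 1) (b := fun _ _ => 0)); try exact: C2k_cst.
by move=> p _; split; [exact: is_derive_id|exact: is_derive_cst].
Qed.

Lemma C2k_snd U n : open U -> C2k n U (fun _ y => y).
Proof.
move=> oU; case: n => [p _|n]; first exact: cvg_snd.
apply: (C2kS oU (a := fun _ _ => 0) (b := fun _ _ => 1)); try exact: C2k_cst.
by move=> p _; split; [exact: is_derive_cst|exact: is_derive_id].
Qed.

Lemma C2k_add U n f g : open U -> C2k n U f -> C2k n U g ->
  C2k n U (fun x y => f x y + g x y).
Proof.
move=> oU; elim: n f g => [f g cf cg p Up|n IH f g cf cg].
  by apply: cvgD; [exact: cf|exact: cg].
have [_ [fu fv]] := cf; have [_ [gu gv]] := cg.
apply: (C2kS oU _ (IH _ _ fu gu) (IH _ _ fv gv)) => p Up; split.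
  exact: is_deriveD (C2k_derive1 cf Up) (C2k_derive1 cg Up).
exact: is_deriveD (C2k_derive2 cf Up) (C2k_derive2 cg Up).
Qed.

Lemma C2k_mul U n f g : open U -> C2k n U f -> C2k n U g ->
  C2k n U (fun x y => f x y * g x y).
Proof.
move=> oU; elim: n f g => [f g cf cg p Up|n IH f g cf cg].
  by apply: cvgM; [exact: cf|exact: cg].
have [_ [fu fv]] := cf; have [_ [gu gv]] := cg.
have f0 := C2kW oU cf; have g0 := C2kW oU cg.
apply: (C2kS oU _ (C2k_add oU (IH _ _ f0 gu) (IH _ _ g0 fu))
                  (C2k_add oU (IH _ _ f0 gv) (IH _ _ g0 fv))) => p Up; split.
  exact: is_deriveM (C2k_derive1 cf Up) (C2k_derive1 cg Up).
exact: is_deriveM (C2k_derive2 cf Up) (C2k_derive2 cg Up).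
Qed.

Lemma C2k_opp U n f : open U -> C2k n U f -> C2k n U (fun x y => - f x y).
Proof.
move=> oU cf; have := C2k_mul oU (C2k_cst _ (-1) oU) cf.
by apply: eq_C2k => // q _; rewrite mulN1r.
Qed.

Lemma C2k_sub_fun U n f g : open U -> C2k n U f -> C2k n U g ->
  C2k n U (fun x y => f x y - g x y).
Proof. by move=> oU cf cg; apply: C2k_add => //; exact: C2k_opp. Qed.

Lemma C2k_exp U n f m : open U -> C2k n U f -> C2k n U (fun x y => f x y ^+ m).
Proof.
move=> oU cf; elim: m => [|m IH]; first exact: C2k_cst.
by have := C2k_mul oU cf IH; apply: eq_C2k => // q _; rewrite exprS.
Qed.

Lemma C2k_inv U n f : open U -> (forall p, U p -> f p.1 p.2 != 0) -> C2k n U f ->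
  C2k n U (fun x y => (f x y)^-1).
Proof.
move=> oU fn0; elim: n => [cf p Up|n IH cf].
  by apply: cvgV; [exact: fn0|exact: cf].
have [_ [fu fv]] := cf; have f0 := IH (C2kW oU cf).
have nf2 := C2k_opp oU (C2k_exp 2 oU f0).
apply: (C2kS oU _ (C2k_mul oU nf2 fu) (C2k_mul oU nf2 fv)) => p Up; split.
  have := is_deriveV _ (C2k_derive1 cf Up); rewrite exprVn; apply; exact: fn0.
have := is_deriveV _ (C2k_derive2 cf Up); rewrite exprVn; apply; exact: fn0.
Qed.

Lemma C2k_sqrt U n f : open U -> (forall p, U p -> 0 < f p.1 p.2) -> C2k n U f ->
  C2k n U (fun x y => Num.sqrt (f x y)).
Proof.
move=> oU fn0; elim: n => [cf p Up|n IH cf].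
  apply: (@continuous_comp _ _ _ (fun q => f q.1 q.2) Num.sqrt); first exact: cf.
  exact: sqrt_continuous.
have [_ [fu fv]] := cf; have f0 := IH (C2kW oU cf).
have nf2 : C2k n U (fun x y => (2 * Num.sqrt (f x y))^-1).
  apply: C2k_inv => //; last by apply: C2k_mul => //; exact: C2k_cst.
  by move=> p /fn0 fp; rewrite mulf_neq0// ?gt_eqF// sqrtr_gt0.
apply: (C2kS oU _ (C2k_mul oU nf2 fu) (C2k_mul oU nf2 fv)) => p Up; split.
  exact: (is_derive1_comp (is_derive1_sqrt (fn0 _ Up)) (C2k_derive1 cf Up)).
exact: (is_derive1_comp (is_derive1_sqrt (fn0 _ Up)) (C2k_derive2 cf Up)).
Qed.

(** Inserting the curve in the Caratheodory factorisation of [f], and factoring the increments of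
    [a] and [b] in the same way, gives a slope of the composite that is continuous at [t]. *)
Lemma chain_rule U f (a b : R -> R) (t da db : R) : open U -> C2k 1 U f -> U (a t, b t) ->
  is_derive t 1 a da -> is_derive t 1 b db ->
  is_derive t 1 (fun t => f (a t) (b t)) (pu f (a t) (b t) * da + pv f (a t) (b t) * db).
Proof.
move=> oU Cf Up Da Db.
have [A [B [cA cB /= <- <- E]]] := C2k_open_caratheodory oU Cf Up.
have ca : {for t, continuous a} by apply: differentiable_continuous; apply/derivable1_diffP; exact: ex_derive.
have cb : {for t, continuous b} by apply: differentiable_continuous; apply/derivable1_diffP; exact: ex_derive.
have cab : {for t, continuous (fun t => (a t, b t))} by exact: continuous_pair.
move/is_derive1_caratheodory : Da => [ga [Ea cga <-]].
move/is_derive1_caratheodory : Db => [gb [Eb cgb <-]].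
apply: (@is_derive_slope _ (fun z => A (a z, b z) * ga z + B (a z, b z) * gb z)).
  by apply/nbhs_itvP; exists 1 => // z _; have /= := E (a z, b z); rewrite Ea Eb => ->; ring.
have cA' : {for t, continuous (fun z => A (a z, b z))}.
  exact: (@continuous_comp _ _ _ (fun t => (a t, b t)) A).
have cB' : {for t, continuous (fun z => B (a z, b z))}.
  exact: (@continuous_comp _ _ _ (fun t => (a t, b t)) B).
exact: (cvgD (cvgM cA' cga) (cvgM cB' cgb)).
Qed.

(** The induction also varies [f], since the partial derivatives of the composite involve [pu f] and
    [pv f]; taking [f] smooth of every order avoids counting its orders. *)
Lemma C2k_comp U V n f g1 g2 : open U -> open V ->
  (forall p, U p -> V (g1 p.1 p.2, g2 p.1 p.2)) ->
  (forall m, C2k m V f) -> C2k n U g1 -> C2k n U g2 ->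
  C2k n U (fun x y => f (g1 x y) (g2 x y)).
Proof.
move=> oU oV UV; elim: n f g1 g2 UV => [|n IH] f g1 g2 UV cf c1 c2.
  move=> p Up; apply: (@continuous_comp _ _ _ (fun q => (g1 q.1 q.2, g2 q.1 q.2)) (fun q => f q.1 q.2)).
    by apply: continuous_pair; [exact: c1|exact: c2].
  exact: (cf 0 _ (UV _ Up)).
have cfu m : C2k m V (pu f) by have [_ []] := cf m.+1.
have cfv m : C2k m V (pv f) by have [_ []] := cf m.+1.
have w1 := C2kW oU c1; have w2 := C2kW oU c2.
have fu := IH _ _ _ UV cfu w1 w2; have fv := IH _ _ _ UV cfv w1 w2.
have [_ [u1 v1]] := c1; have [_ [u2 v2]] := c2.
apply: (C2kS oU _ (C2k_add oU (C2k_mul oU fu u1) (C2k_mul oU fv u2))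
                  (C2k_add oU (C2k_mul oU fu v1) (C2k_mul oU fv v2))) => p Up; split.
  exact: (chain_rule oV (cf 1) (UV _ Up) (C2k_derive1 c1 Up) (C2k_derive1 c2 Up)).
exact: (chain_rule oV (cf 1) (UV _ Up) (C2k_derive2 c1 Up) (C2k_derive2 c2 Up)).
Qed.

End Analysis.

(** * Symmetry of second derivatives and division by powers of a variable *)

Section Division.
Variable R : realType.
Implicit Types (f g : R -> R -> R) (p q : R * R) (U V : set (R * R)).

Lemma sq_open (e : R) : open (sq e).
Proof.
rewrite openE => p [p1 p2]; apply/nbhs_boxP.
exists (Num.min (e - `|p.1|) (e - `|p.2|)); first by rewrite lt_min !subr_gt0 p1 p2.
move=> q; rewrite !lt_min => /andP[a1 _] /andP[_ a2]; split.
  have := ler_normD (q.1 - p.1) p.1; rewrite subrK; lra.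
have := ler_normD (q.2 - p.2) p.2; rewrite subrK; lra.
Qed.

(** The mean value theorem is used twice: in [x] for the difference of two horizontal slices, then
    in [y] for [pu f c]. *)
Lemma second_difference f p (h : R) : 0 < h ->
  (forall q, `|q.1 - p.1| <= h -> `|q.2 - p.2| <= h ->
     derivable (fun x => f x q.2) q.1 1 /\ derivable (fun y => pu f q.1 y) q.2 1) ->
  exists c : R * R, [/\ `|c.1 - p.1| <= h, `|c.2 - p.2| <= h &
    f (p.1 + h) (p.2 + h) - f (p.1 + h) p.2 - f p.1 (p.2 + h) + f p.1 p.2 =
    pv (pu f) c.1 c.2 * h * h].
Proof.
move=> h0 D.
have hE a : a + h - a = h by rewrite addrC addKr.
have hh a : `|a + h - a| = h by rewrite hE ger0_norm// ltW.
have [|c [c1 _ Ec]] := @mvt R (fun x => f x (p.2 + h) - f x p.2)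
  (fun x => pu f x (p.2 + h) - pu f x p.2) p.1 (p.1 + h).
  move=> z; rewrite hh => zp; apply: is_deriveB; apply: derivable_pu.
    have hq : `|(z, p.2 + h).2 - p.2| <= h by rewrite hh.
    exact: (D (z, p.2 + h) zp hq).1.
  have hq : `|(z, p.2).2 - p.2| <= h by rewrite subrr normr0 ltW.
  exact: (D (z, p.2) zp hq).1.
rewrite hh in c1.
have [|d [d1 _ Ed]] := @mvt R (fun y => pu f c y) (fun y => pv (pu f) c y) p.2 (p.2 + h).
  by move=> z; rewrite hh => zp; apply: derivable_pv; have [] := D (c, z).
rewrite hh in d1; exists (c, d); split => //=.
by rewrite !hE in Ec Ed; rewrite -Ed -Ec opprB; move: (f _ _) (f _ _) (f _ _) (f _ _) => *; ring.
Qed.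

Lemma dist_midpoint (x y z e : R) : `|z - x| < e / 2 -> `|z - y| < e / 2 -> `|x - y| <= e.
Proof.
move=> zx zy; rewrite -(subrKA z x) -[x - z]opprB.
by apply: le_trans (ler_normD _ _) _; rewrite normrN; lra.
Qed.

Lemma mulIf2 (x y h : R) : 0 < h -> x * h * h = y * h * h -> x = y.
Proof. by move=> /lt0r_neq0 h0 /(mulIf h0)/(mulIf h0). Qed.

Lemma is_deriveXn (k : nat) (z : R) :
  is_derive z 1 (fun x : R => x ^+ k.+1) (k.+1%:R * z ^+ k).
Proof.
have -> : (fun x : R => x ^+ k.+1) = id ^+ k.+1 by rewrite exprfctE.
apply: (is_derive_eq (is_deriveX k.+1 (@is_derive_id R R z 1))).
by rewrite /GRing.scale /= mulr1.
Qed.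

Lemma is_derive_mulf (f g : R -> R) (x a b : R) : is_derive x 1 f a -> is_derive x 1 g b ->
  is_derive x 1 (fun z => f z * g z) (f x * b + g x * a).
Proof. exact: is_deriveM. Qed.

Lemma is_derive_invf (f : R -> R) (x a : R) : f x != 0 -> is_derive x 1 f a ->
  is_derive x 1 (fun z => (f z)^-1) (- f x ^- 2 * a).
Proof. exact: is_deriveV. Qed.

(** The second difference over a square of side [h] is symmetric in the two variables, so the mixed
    derivatives take a common value at suitable points within [h] of [p]; by continuity their
    difference at [p] is at most any [eps]. *)
Lemma schwarz U f p : open U -> C2k 2 U f -> U p ->
  pv (pu f) p.1 p.2 = pu (pv f) p.1 p.2.
Proof.
move=> oU [D [[Du [_ cuv]] [Dv [cvu _]]]] Up.
have /nbhs_boxP[e e0 He] : nbhs p U by exact: open_nbhs_nbhs.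
apply/eqP; rewrite -subr_eq0 -normr_le0; apply/ler_addgt0Pl => eps eps0; rewrite addr0.
have eps2 : 0 < eps / 2 by lra.
have /cvgP_box/(_ _ eps2)[d1 d10 H1] := cuv _ Up.
have /cvgP_box/(_ _ eps2)[d2 d20 H2] := cvu _ Up.
pose h := Num.min e (Num.min d1 d2) / 2.
have m0 : 0 < Num.min e (Num.min d1 d2) by rewrite !lt_min e0 d10 d20.
have h0 : 0 < h by rewrite /h; lra.
have hm : h < Num.min e (Num.min d1 d2) by rewrite /h; lra.
move: hm; rewrite !lt_min => /andP[he /andP[hd1 hd2]].
have UU q : `|q.1 - p.1| <= h -> `|q.2 - p.2| <= h -> U q.
  by move=> q1 q2; apply: He; exact: le_lt_trans he.
have [c [c1 c2 Ec]] := @second_difference f p h h0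
  (fun q a1 a2 => conj (D q (UU _ a1 a2)).1 (Du q (UU _ a1 a2)).2).
have [b [b1 b2 Eb]] := @second_difference (fun x y => f y x) (p.2, p.1) h h0
  (fun q a1 a2 => conj (D (q.2, q.1) (UU (q.2, q.1) a2 a1)).2 (Dv (q.2, q.1) (UU (q.2, q.1) a2 a1)).1).
rewrite /= in b1 b2 Eb.
have Eb' : f (p.1 + h) (p.2 + h) - f (p.1 + h) p.2 - f p.1 (p.2 + h) + f p.1 p.2 =
           pu (pv f) b.2 b.1 * h * h by rewrite -[RHS]Eb; move: (f _ _) (f _ _) (f _ _) (f _ _) => *; ring.
have E : pv (pu f) c.1 c.2 = pu (pv f) b.2 b.1.
  exact: (mulIf2 h0 (etrans (esym Ec) Eb')).
have A1 := H1 c (le_lt_trans c1 hd1) (le_lt_trans c2 hd1).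
have A2 := H2 (b.2, b.1) (le_lt_trans b2 hd2) (le_lt_trans b1 hd2).
rewrite /= in A1 A2; rewrite E in A1.
exact: (dist_midpoint A1 A2).
Qed.

(** Cauchy's mean value theorem for [W] and [z ^+ k.+1]: with [C] the quotient at [u], the function
    [W z - C * z ^+ k.+1] vanishes at [0] and [u], so its derivative [z ^+ k * (f z - C * k.+1%:R)]
    vanishes at some nonzero [c]. *)
Lemma divided_mvt (k : nat) (W f : R -> R) (u : R) :
  (forall z : R, `|z| <= `|u| -> is_derive z 1 W (z ^+ k * f z)) -> W 0 = 0 -> u != 0 ->
  exists2 c, `|c| <= `|u| & c != 0 /\ W u / u ^+ k.+1 = f c / k.+1%:R.
Proof.
move=> D W0 u0; set C := W u / u ^+ k.+1.
have [|c [c1 cn0]] := @mvt R (fun z => W z - C * z ^+ k.+1)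
  (fun z => z ^+ k * f z - C * (k.+1%:R * z ^+ k)) 0 u.
  move=> z; rewrite !subr0 => zu; apply: is_deriveB; first exact: D.
  exact: (is_deriveZ C (is_deriveXn k z)).
rewrite !subr0 in c1; rewrite W0 expr0n /= mulr0 !subr0 /C divfK ?expf_neq0// subrr -/C.
move/esym/eqP; rewrite mulf_eq0 (negPf u0) orbF => /eqP E.
exists c => //; have c0 := cn0 u0; split => //.
have : c ^+ k * (f c - C * k.+1%:R) = 0 by rewrite -E; ring.
move/eqP; rewrite mulf_eq0 expf_eq0 (negPf c0) andbF /= subr_eq0 => /eqP ->.
by rewrite mulfK// pnatr_eq0.
Qed.

(** The slope at [0] of the completed quotient is [(W z - f 0 / k.+1%:R * z ^+ k.+1) / z ^+ k.+2].
    Its numerator has derivative [z ^+ k.+1 * g z] with [g] the slope of [f] at [0], so by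
    [divided_mvt] it equals [g c / k.+2%:R] for some [c] no farther from [0] than [z]. *)
Lemma divided_derive0 (k : nat) (W f : R -> R) (e l : R) : 0 < e ->
  (forall z : R, `|z| < e -> is_derive z 1 W (z ^+ k * f z)) -> W 0 = 0 ->
  is_derive (0 : R) 1 f l ->
  is_derive (0 : R) 1 (fun z => if z == 0 then f 0 / k.+1%:R else W z / z ^+ k.+1) (l / k.+2%:R).
Proof.
move=> e0 D W0 Df.
set G := fun z : R => _.
pose s z := if z == 0 then l / k.+2%:R else (G z - G 0) / z.
have -> : l / k.+2%:R = s 0 by rewrite /s eqxx.
apply: is_derive_slope.
  apply/nbhs_itvP; exists 1 => // z _; rewrite /s; case: eqP => [->|/eqP z0].
    by rewrite !subrr mulr0.
  by rewrite subr0 divfK.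
move/is_derive1_caratheodory : Df => [g [fg gc gl]].
apply/cvgrPdist_lt => eps eps0.
move/cvgrPdist_lt : gc => /(_ _ eps0) /nbhs_itvP[d d0 Hd].
apply/nbhs_itvP; exists (Num.min e d); first by rewrite lt_min e0 d0.
move=> z; rewrite subr0 lt_min => /andP[ze zd].
rewrite /s eqxx -gl; case: eqP => [_|/eqP z0]; first by rewrite subrr normr0.
have [|||c cz [c0 Ec]] := @divided_mvt k.+1 (fun z => W z - f 0 / k.+1%:R * z ^+ k.+1) g z.
- move=> y yz; have ye : `|y| < e := le_lt_trans yz ze.
  have -> : y ^+ k.+1 * g y = y ^+ k * f y - f 0 / k.+1%:R * (k.+1%:R * y ^+ k).
    have := fg y; rewrite subr0 exprS => Eg.
    have -> : y * y ^+ k * g y = y ^+ k * (g y * y) by ring.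
    by rewrite -Eg mulrA divfK ?pnatr_eq0// mulrBr [f 0 * _]mulrC.
  apply: is_deriveB; first exact: D.
  exact: (is_deriveZ (f 0 / k.+1%:R) (is_deriveXn k y)).
- by rewrite W0 expr0n mulr0 subrr.
- exact: z0.
- rewrite /G eqxx (negPf z0).
  have -> : (W z / z ^+ k.+1 - f 0 / k.+1%:R) / z =
     (W z - f 0 / k.+1%:R * z ^+ k.+1) / z ^+ k.+2.
    by move: (f 0 / _) => C; rewrite !exprS; field; rewrite z0 expf_neq0.
  rewrite Ec -mulrBl normrM normfV.
  have k1 : 1 <= `|k.+2%:R| :> R by rewrite ger0_norm// ler1n.
  rewrite ltr_pdivrMr; last by lra.
  have /Hd : `|c - 0| < d by rewrite subr0; exact: le_lt_trans zd.
  by rewrite -[X in _ -> _ < X]/(eps * _); nra.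
Qed.

(* When [W_u = u^k f] and [W = 0] on [u = 0], this is the smooth function
   [\int_0^1 t^k f(t u, v) dt]. *)
Definition divu (k : nat) (W f : R -> R -> R) (u v : R) : R :=
  if u == 0 then f 0 v / k.+1%:R else W u v / u ^+ k.+1.

Lemma divu_mul k W f (u v : R) : W 0 v = 0 -> W u v = u ^+ k.+1 * divu k W f u v.
Proof.
move=> W0; rewrite /divu; case: eqP => [->|/eqP u0]; first by rewrite expr0n mul0r.
by rewrite mulrC divfK// expf_neq0.
Qed.

Section DivuSmooth.
Variable e : R.
Let S := @sq R e.
Let oS : open S := @sq_open e.

(** A condition on the pair [(W, f)] inherited by the pairs whose quotients are the partial
    derivatives of [divu k W f]; this makes induction on the order possible. *)
Definition divisible k W f := [/\ (forall m, C2k m S W), (forall m, C2k m S f),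
  (forall q, S q -> pu W q.1 q.2 = q.1 ^+ k * f q.1 q.2) & (forall q, S q -> W 0 q.2 = 0)].

Lemma divisible_derive k W f q : divisible k W f -> S q ->
  is_derive q.1 1 (fun x => W x q.2) (q.1 ^+ k * f q.1 q.2).
Proof. by move=> [cW _ E _] Sq; rewrite -E//; exact: C2k_derive1 (cW 1%N) Sq. Qed.

Lemma sq0 q : S q -> S (0, q.2).
Proof. by move=> [q1 q2]; split => //=; rewrite normr0; exact: le_lt_trans q2. Qed.

Lemma sq_shrink q (z : R) : S q -> `|z| <= `|q.1| -> S (z, q.2).
Proof. by move=> [q1 q2] zq; split => //=; exact: le_lt_trans q1. Qed.

Lemma divu_val k W f q : divisible k W f -> S q ->
  exists2 c, `|c| <= `|q.1| & divu k W f q.1 q.2 = f c q.2 / k.+1%:R.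
Proof.
move=> H Sq; rewrite /divu; case: eqP => [->|/eqP q0]; first by exists 0.
have [|||c cq [_ ->]] := @divided_mvt k (fun x => W x q.2) (fun x => f x q.2) q.1.
- by move=> z zq; exact: divisible_derive (sq_shrink Sq zq).
- by have [_ _ _] := H; exact.
- exact: q0.
by exists c.
Qed.

(** The new [W] is the numerator of the [u]-derivative of [W / u ^+ k.+1] over the denominator
    [u ^+ k.+2]. In its own [u]-derivative the terms in [u ^+ k * f] cancel and [u ^+ k.+1 * pu f]
    remains. *)
Lemma divisible_u k W f : divisible k W f ->
  divisible k.+1 (fun u v => u ^+ k.+1 * f u v - k.+1%:R * W u v) (pu f).
Proof.
move=> H; have [cW cf E W0] := H; split.
- move=> m; apply: C2k_sub_fun => //; apply: C2k_mul => //; last exact: C2k_cst.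
  by apply: C2k_exp => //; exact: C2k_fst.
- by move=> m; have [_ []] := cf m.+1.
- move=> q Sq.
  have Df := C2k_derive1 (cf 1%N) Sq.
  have DX := is_deriveXn k q.1.
  have DW := is_deriveZ k.+1%:R (divisible_derive H Sq).
  apply: (proj2 (is_derive_puP _)).
  apply: (is_derive_eq (is_deriveB (is_deriveM DX Df) DW)).
  by rewrite /GRing.scale /= exprS; move: (pu _ _ _) (f _ _) => *; ring.
- by move=> q Sq; rewrite W0// expr0n mul0r mulr0 subrr.
Qed.

(** Symmetry of the mixed derivatives turns [pu (pv W)] into the [v]-derivative of [u ^+ k * f]. *)
Lemma divisible_v k W f : divisible k W f -> divisible k (pv W) (pv f).
Proof.
move=> H; have [cW cf E W0] := H; split.
- by move=> m; have [_ []] := cW m.+1.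
- by move=> m; have [_ []] := cf m.+1.
- move=> q Sq; rewrite -(schwarz oS (cW 2%N) Sq).
  rewrite (@eq_pv _ S _ (fun u v => u ^+ k * f u v))//.
  apply: (proj2 (is_derive_pvP _)).
  exact: (is_deriveZ (q.1 ^+ k) (C2k_derive2 (cf 1%N) Sq)).
- move=> q Sq; rewrite /pv derive1E (@near_eq_derive _ _ _ _ (cst 0)); last first.
    have : nbhs (0, q.2) S by exact/open_nbhs_nbhs/(conj oS)/sq0.
    by move/near_slice2; apply: filterS => y /W0.
  by rewrite derive_val.
Qed.

Lemma divu_derive1 k W f q : divisible k W f -> S q ->
  is_derive q.1 1 (fun x => divu k W f x q.2)
   (divu k.+1 (fun u v => u ^+ k.+1 * f u v - k.+1%:R * W u v) (pu f) q.1 q.2).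
Proof.
move=> H Sq; have [cW cf E W0] := H; have [q1 q2] := Sq.
have e0 : 0 < e by exact: le_lt_trans q1.
rewrite {2}/divu; case: eqP => [->|/eqP q0].
  (* On the axis [u = 0] the target [divu] takes its completed value [pu f 0 v / k.+2%:R], the
     derivative found in [divided_derive0]. *)
  apply: (@divided_derive0 k (fun x => W x q.2) (fun x => f x q.2) e) => //.
  - by move=> z ze; apply: (@divisible_derive _ _ _ (z, q.2)) => //; split.
  - exact: W0.
  - exact: (C2k_derive1 (cf 1%N) (sq0 Sq)).
apply: (@near_eq_is_derive _ _ _ (fun x => W x q.2 / x ^+ k.+1)).
  apply/nbhs_itvP; exists `|q.1|; first by rewrite normr_gt0.
  move=> z; rewrite /divu; case: eqP => // ->; rewrite sub0r normrN; lra.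
have DX := is_deriveXn k q.1.
have qk : (fun x : R => x ^+ k.+1) q.1 != 0 by rewrite /= expf_neq0.
have DV := @is_derive_invf (fun x => x ^+ k.+1) _ _ qk DX.
apply: is_derive_eq; first exact: (is_derive_mulf (divisible_derive H Sq) DV).
rewrite /= !exprS; field.
by rewrite q0 expf_neq0.
Qed.

Lemma divu_derive2 k W f q : divisible k W f -> S q ->
  is_derive q.2 1 (fun y => divu k W f q.1 y) (divu k (pv W) (pv f) q.1 q.2).
Proof.
move=> H Sq; have [cW cf E W0] := H.
rewrite /divu; case: eqP => [_|/eqP q0].
  have := is_deriveZ k.+1%:R^-1 (C2k_derive2 (cf 1%N) (sq0 Sq)).
  rewrite /GRing.scale /= mulrC; congr is_derive.
  by apply/funext => y /=; rewrite mulrC.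
have := is_deriveZ (q.1 ^+ k.+1)^-1 (C2k_derive2 (cW 1%N) Sq).
rewrite /GRing.scale /= mulrC; congr is_derive.
by apply/funext => y /=; rewrite mulrC.
Qed.

(** Off the axis [u = 0] this is a plain quotient. Near a point of the axis, [divu_val] expresses
    the value by [f] at a point of the same slice no farther from the axis. *)
Lemma divu_continuous k W f : divisible k W f -> C2k 0 S (divu k W f).
Proof.
move=> H p Sp; have [cW cf E W0] := H.
have [p0|p0] := eqVneq p.1 0; last first.
  have C : {for p, continuous (fun q : R * R => W q.1 q.2 / q.1 ^+ k.+1)}.
    apply: cvgM; first exact: (cW 0%N).
    apply: cvgV; first by rewrite expf_neq0.
    exact: (@C2k_exp _ setT 0%N (fun x _ => x) k.+1 openT (C2k_fst _ openT)).
  have E0 : divu k W f p.1 p.2 = W p.1 p.2 / p.1 ^+ k.+1 by rewrite /divu (negPf p0).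
  suff : divu k W f q.1 q.2 @[q --> p] --> W p.1 p.2 / p.1 ^+ k.+1 by rewrite -E0.
  apply: cvg_trans C; apply: near_eq_cvg.
  apply/nbhs_boxP; exists `|p.1|; first by rewrite normr_gt0.
  move=> q qp _; rewrite /divu; case: eqP => // q0.
  by move: qp; rewrite q0 sub0r normrN; lra.
apply/cvgP_box => eps eps0.
have /cvgP_box/(_ _ eps0)[d d0 Hd] := cf 0%N _ Sp.
have /nbhs_boxP[d' d'0 Hd'] : nbhs p S by exact: open_nbhs_nbhs.
exists (Num.min d d'); first by rewrite lt_min d0.
move=> q; rewrite !lt_min => /andP[a1 a2] /andP[b1 b2].
have [c cq ->] := divu_val H (Hd' _ a2 b2).
have -> : divu k W f p.1 p.2 = f p.1 p.2 / k.+1%:R by rewrite /divu p0 eqxx.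
rewrite -mulrBl normrM normfV.
have k1 : 1 <= `|k.+1%:R| :> R by rewrite ger0_norm// ler1n.
rewrite ltr_pdivrMr; last by lra.
have c1 : `|(c, q.2).1 - p.1| < d.
  by rewrite p0 subr0 in a1; rewrite /= p0 subr0; exact: le_lt_trans a1.
have /= := Hd (c, q.2) c1 b1; nra.
Qed.

Lemma divu_C2k n k W f : divisible k W f -> C2k n S (divu k W f).
Proof.
elim: n k W f => [|n IH] k W f H; first exact: divu_continuous.
apply: (C2kS oS _ (IH _ _ _ (divisible_u H)) (IH _ _ _ (divisible_v H))).
by move=> p Sp; split; [exact: divu_derive1|exact: divu_derive2].
Qed.

End DivuSmooth.
End Division.

(** * Implicit functions *)

Section Implicit.
Variable R : realType.
Implicit Types (f g : R -> R -> R) (p q : R * R) (U V : set (R * R)).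

Variables (Phi : R -> R -> R) (e d : R).
Hypothesis CPhi : forall n, C2k n (sq e) Phi.
Hypothesis Phi_gt0 : forall q, sq e q -> 0 < pu Phi q.1 q.2.

Let oe : open (@sq R e) := @sq_open R e.
Let od : open (@sq R d) := @sq_open R d.

Lemma mono_slice (x1 x2 y : R) : `|x1| < e -> `|x2| < e -> `|y| < e -> x1 < x2 ->
  Phi x1 y < Phi x2 y.
Proof.
move=> h1 h2 hy x12.
have S z : x1 <= z <= x2 -> sq e (z, y).
  by move=> /andP[a b]; split => //=; move: h1 h2; rewrite !ltr_norml => /andP[? ?] /andP[? ?]; apply/andP; split; lra.
have D z : z \in `[x1, x2]%R -> is_derive z 1 (fun x => Phi x y) (pu Phi z y).
  by rewrite in_itv /= => /S zS; exact: (C2k_derive1 (CPhi 1%N) zS).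
have Do z : z \in `]x1, x2[%R -> is_derive z 1 (fun x => Phi x y) (pu Phi z y).
  by move=> zi; apply: D; exact: subset_itv_oo_cc zi.
have Dc : {within `[x1, x2], continuous (fun x => Phi x y)}.
  by apply: derivable_within_continuous => z /D dz; exact: ex_derive.
have [c ci E] := MVT x12 Do Dc.
have /S/Phi_gt0 /= P : x1 <= c <= x2 by have := subset_itv_oo_cc ci; rewrite in_itv.
by rewrite -subr_gt0 E mulr_gt0// subr_gt0.
Qed.

Lemma inj_slice (x1 x2 y : R) : `|x1| < e -> `|x2| < e -> `|y| < e ->
  Phi x1 y = Phi x2 y -> x1 = x2.
Proof.
move=> h1 h2 hy E; case: (ltgtP x1 x2) => // H; have := mono_slice _ _ hy H.
  by rewrite E ltxx => /(_ h1 h2).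
by rewrite E ltxx => /(_ h2 h1).
Qed.

(** The root of [Phi x y = X] with the norm of [x] below [e], unique by [inj_slice] when [y] is also
    in range; the value is [0] if there is no root. *)
Definition slice_inv (X y : R) : R := xget 0 [set x | `|x| < e /\ Phi x y = X].
Local Notation xi := slice_inv.

Lemma slice_invK (x y : R) : `|x| < e -> `|y| < e -> xi (Phi x y) y = x.
Proof.
move=> hx hy; have [] := @xgetPex _ 0 [set z | `|z| < e /\ Phi z y = Phi x y].
  by exists x.
by rewrite -/(xi _ _) => a b; exact: inj_slice b.
Qed.

Hypothesis de : d <= e.
Hypothesis ex_slice : forall q, sq d q -> exists2 x, `|x| < e & Phi x q.2 = q.1.

Lemma slice_invP q : sq d q -> `|xi q.1 q.2| < e /\ Phi (xi q.1 q.2) q.2 = q.1.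
Proof.
by move=> /ex_slice[x hx E]; apply: (@xgetPex _ 0 [set x | `|x| < e /\ _]); exists x.
Qed.

Lemma slice_inv_sq q : sq d q -> sq e (xi q.1 q.2, q.2).
Proof. by move=> Sq; split => /=; [have [] := slice_invP Sq|have [_ h] := Sq; exact: lt_le_trans de]. Qed.

(** Strict monotonicity traps the root: at [p] the values of [Phi] at [x0 - r] and [x0 + r] lie
    strictly on either side of the prescribed value, and this persists for [q] near [p]. *)
Lemma slice_inv_continuous : C2k 0 (sq d) xi.
Proof.
move=> p Sp; have [hx Ex] := slice_invP Sp; have [Sx1 Sx2] := slice_inv_sq Sp.
rewrite /= in Sx1 Sx2; set x0 := xi p.1 p.2 in hx Ex Sx1 *.
apply/cvgP_box => eps eps0.
(* Half the minimum keeps [x0 - r] and [x0 + r] inside the domain and [r] below [eps]. *)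
pose r := Num.min eps (e - `|x0|) / 2.
have m0 : 0 < Num.min eps (e - `|x0|) by rewrite lt_min eps0 subr_gt0.
have r0 : 0 < r by rewrite /r; lra.
have : r < Num.min eps (e - `|x0|) by rewrite /r; lra.
rewrite lt_min => /andP[reps re].
have hp : `|x0 + r| < e by apply: le_lt_trans (ler_normD _ _) _; rewrite (gtr0_norm r0); lra.
have hm : `|x0 - r| < e by apply: le_lt_trans (ler_normB _ _) _; rewrite (gtr0_norm r0); lra.
have cP x : `|x| < e -> {for p, continuous (fun q : R * R => Phi x q.2 - q.1)}.
  move=> hx'; apply: cvgB; last exact: cvg_fst.
  apply: (@continuous_comp _ _ _ (fun q : R * R => (x, q.2)) (fun q => Phi q.1 q.2)).
    by apply: continuous_pair; [exact: cvg_cst|exact: cvg_snd].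
  by apply: (CPhi 0%N); split.
have gp : 0 < Phi (x0 + r) p.2 - p.1 by rewrite subr_gt0 -Ex; apply: mono_slice => //; lra.
have gm : Phi (x0 - r) p.2 - p.1 < 0 by rewrite subr_lt0 -Ex; apply: mono_slice => //; lra.
have /cvgP_box/(_ _ gp)[d1 d10 H1] := cP _ hp.
have gm' : 0 < - (Phi (x0 - r) p.2 - p.1) by lra.
have /cvgP_box/(_ _ gm')[d2 d20 H2] := cP _ hm.
have /nbhs_boxP[d3 d30 H3] : nbhs p (sq d) by exact: open_nbhs_nbhs.
exists (Num.min d1 (Num.min d2 d3)); first by rewrite !lt_min d10 d20.
move=> q; rewrite !lt_min => /and3P[a1 a2 a3] /and3P[b1 b2 b3].
have Sq := H3 _ a3 b3; have [hq Eq] := slice_invP Sq; have [_ hq2] := slice_inv_sq Sq.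
rewrite /= in hq2.
have h1 : Phi (x0 - r) q.2 < q.1.
  by have := H2 _ a2 b2; rewrite ltr_norml => /andP[_]; move: (Phi _ _) (Phi _ _) => ? ?; lra.
have h2 : q.1 < Phi (x0 + r) q.2.
  by have := H1 _ a1 b1; rewrite ltr_norml => /andP[+ _]; move: (Phi _ _) (Phi _ _) => ? ?; lra.
rewrite /= -/x0 ltr_norml; set z := xi q.1 q.2 in hq Eq *.
have k1 : x0 - r < z.
  rewrite ltNge; apply/negP; rewrite le_eqVlt => /orP[/eqP zE|zl].
    by move: h1; rewrite -zE Eq ltxx.
  by have := lt_trans (mono_slice hq hm hq2 zl) h1; rewrite Eq ltxx.
have k2 : z < x0 + r.
  rewrite ltNge; apply/negP; rewrite le_eqVlt => /orP[/eqP zE|zl].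
    by move: h2; rewrite zE Eq ltxx.
  by have := lt_trans h2 (mono_slice hp hq hq2 zl); rewrite Eq ltxx.
by apply/andP; split; lra.
Qed.

(** The Caratheodory factorisation of [Phi] is evaluated at [(xi q.1 q.2, q.2)], where [Phi] returns
    [q.1]; this is a linear relation between the increments of [xi] and of its arguments. *)
Lemma slice_inv_caratheodory p : sq d p -> exists A B : R * R -> R,
  [/\ {for p, continuous A}, {for p, continuous B},
      A p = pu Phi (xi p.1 p.2) p.2, B p = pv Phi (xi p.1 p.2) p.2 &
      forall q, sq d q -> q.1 - p.1 = A q * (xi q.1 q.2 - xi p.1 p.2) + B q * (q.2 - p.2)].
Proof.
move=> Sp; have [A [B [cA cB /= EA EB E]]] :=
  C2k_open_caratheodory oe (CPhi 1%N) (slice_inv_sq Sp).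
have cx : {for p, continuous (fun q : R * R => (xi q.1 q.2, q.2))}.
  by apply: continuous_pair; [exact: slice_inv_continuous|exact: cvg_snd].
exists (fun q => A (xi q.1 q.2, q.2)), (fun q => B (xi q.1 q.2, q.2)); split => //.
- exact: (@continuous_comp _ _ _ (fun q : R * R => (xi q.1 q.2, q.2)) A).
- exact: (@continuous_comp _ _ _ (fun q : R * R => (xi q.1 q.2, q.2)) B).
move=> q Sq; have [_ Eq] := slice_invP Sq; have [_ Ep] := slice_invP Sp.
by have /= := E (xi q.1 q.2, q.2); rewrite Eq Ep.
Qed.

(** Along the horizontal and vertical lines through [p] the relation of [slice_inv_caratheodory] is
    solved for the increment of [xi], since [A] is nonzero near [p]. *)
Lemma slice_inv_derive p : sq d p ->
  is_derive p.1 1 (fun x => xi x p.2) (pu Phi (xi p.1 p.2) p.2)^-1 /\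
  is_derive p.2 1 (fun y => xi p.1 y)
    (- pv Phi (xi p.1 p.2) p.2 * (pu Phi (xi p.1 p.2) p.2)^-1).
Proof.
move=> Sp; have [A [B [cA cB EA EB E]]] := slice_inv_caratheodory Sp.
have A0 : 0 < A p by rewrite EA; exact: (Phi_gt0 (slice_inv_sq Sp)).
rewrite -EA -EB.
have cV : {for p, continuous (fun q => (A q)^-1)} by apply: cvgV => //; rewrite gt_eqF.
have cBV : {for p, continuous (fun q => - B q * (A q)^-1)}.
  by apply: cvgM => //; exact: cvgN.
have nA : \forall q \near p, A q != 0 /\ sq d q.
  have : \forall q \near p, A q != 0 by apply: (cvgr_neq0 _ cA); rewrite gt_eqF.
  have : nbhs p (sq d) by exact: open_nbhs_nbhs.
  by apply: filterS2 => q.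
case: p Sp E A0 cV cBV nA {cA cB EA EB} => p1 p2 /= Sp E A0 cV cBV nA; split.
- apply: (@is_derive_slope R (fun x => xi x p2) (fun x => (A (x, p2))^-1)).
    move: (near_slice1 nA); apply: filterS => z /= [Az Sz].
    by have := E _ Sz; rewrite /= subrr mulr0 addr0 => ->; rewrite mulKf.
  apply: (@continuous_comp _ _ _ (fun x : R => (x, p2)) (fun q => (A q)^-1)) => //.
  by apply: continuous_pair; [exact: cvg_id|exact: cvg_cst].
- apply: (@is_derive_slope R (fun y => xi p1 y) (fun y => - B (p1, y) * (A (p1, y))^-1)).
    move: (near_slice2 nA); apply: filterS => z /= [Az Sz].
    have := E _ Sz; rewrite /= subrr => Ez.
    have {}Ez : A (p1, z) * (xi p1 z - xi p1 p2) = - B (p1, z) * (z - p2).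
      by rewrite mulNr; apply/eqP; rewrite -addr_eq0 -Ez.
    by rewrite mulrAC -Ez mulrAC mulfV// mul1r.
  apply: (@continuous_comp _ _ _ (fun y : R => (p1, y)) (fun q => - B q * (A q)^-1)) => //.
  by apply: continuous_pair; [exact: cvg_cst|exact: cvg_id].
Qed.

(** Bootstrapping: the partial derivatives of [xi] are built from those of [Phi] at [(xi, y)], so
    they have at least the order of [xi]. *)
Lemma slice_inv_C2k n : C2k n (sq d) xi.
Proof.
elim: n => [|n IH]; first exact: slice_inv_continuous.
have Cu m : C2k m (sq e) (pu Phi) by have [_ []] := CPhi m.+1.
have Cv m : C2k m (sq e) (pv Phi) by have [_ []] := CPhi m.+1.
have cs := C2k_snd n od.
have cu := C2k_comp od oe slice_inv_sq Cu IH cs.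
have cv := C2k_comp od oe slice_inv_sq Cv IH cs.
have ci : C2k n (sq d) (fun x y => (pu Phi (xi x y) y)^-1).
  by apply: C2k_inv => // p /slice_inv_sq/Phi_gt0 /= h; rewrite gt_eqF.
exact: (C2kS od slice_inv_derive ci (C2k_mul od (C2k_opp od cv) ci)).
Qed.

End Implicit.

Section ImplicitGerm.
Variable R : realType.

Lemma implicit_germ (Phi : R -> R -> R) : smooth2_germ Phi -> Phi 0 0 = 0 ->
  0 < pu Phi 0 0 ->
  exists2 xi : R -> R -> R, smooth2_germ xi &
   [/\ xi 0 0 = 0,
       exists2 e : R, 0 < e & forall u v, sq e (u, v) -> Phi (xi u v) v = u
     & exists2 e : R, 0 < e & forall u v, sq e (u, v) -> xi (Phi u v) v = u].
Proof.
move=> [e1 e10 C1] P0 Pu0.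
have S0 (a : R) : 0 < a -> sq a (0, 0) by move=> a0; split; rewrite /= normr0.
have [_ [Cu _]] := C1 1%N.
have /cvgP_box/(_ _ Pu0)[e2 e20 H2] := Cu _ (S0 _ e10).
pose e := Num.min e1 e2.
have e0 : 0 < e by rewrite lt_min e10.
have se : sq e `<=` @sq R e1.
  by move=> q []; rewrite !lt_min => /andP[a _] /andP[b _]; split.
have C n : C2k n (sq e) Phi by exact: C2k_sub (C1 n).
have pos q : sq e q -> 0 < pu Phi q.1 q.2.
  move=> []; rewrite !lt_min => /andP[_ a] /andP[_ b].
  have /= := H2 q; rewrite !subr0 => /(_ a b); rewrite ltr_norml => /andP[+ _].
  by move: (pu _ _ _) (pu _ _ _) => ? ?; lra.
clearbody e; pose r := e / 2.
have r0 : 0 < r by rewrite /r; lra.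
have re : `|r| < e by rewrite gtr0_norm// /r; lra.
have nre : `|- r| < e by rewrite normrN.
have z0 : `|0 : R| < e by rewrite normr0.
have Pr : 0 < Phi r 0 by rewrite -[ltLHS]P0; exact: (mono_slice C pos).
have Pnr : Phi (- r) 0 < 0 by rewrite -[ltRHS]P0; apply: (mono_slice C pos); rewrite ?oppr_lt0.
have Pnr' : 0 < - Phi (- r) 0 by rewrite oppr_gt0.
have h1 : 0 < Phi r 0 / 2 by lra.
have h2 : 0 < - Phi (- r) 0 / 2 by lra.
have /cvgP_box/(_ _ h1)[d1 d10 H1] := C 0%N (r, 0) (conj re z0).
have /cvgP_box/(_ _ h2)[d2 d20 H2'] := C 0%N (- r, 0) (conj nre z0).
(* For [q] in [sq d] the values of [Phi] at [- r] and [r] stay beyond half of their values at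
   [q.2 = 0], while [q.1] lies between these halves; the intermediate value theorem then gives a
   root. *)
pose d := Num.min (Num.min d1 d2) (Num.min (Num.min (Phi r 0 / 2) (- Phi (- r) 0 / 2)) e).
have d0 : 0 < d by rewrite /d !lt_min d10 d20 h1 h2 ?e0 ?e10 ?e20.
have de : d <= e by rewrite /d !ge_min lexx !orbT.
have ex q : sq d q -> exists2 x, `|x| < e & Phi x q.2 = q.1.
  move=> [q1 q2]; have q2e := lt_le_trans q2 de.
  move: q1 q2; rewrite !lt_min => /andP[_ /andP[/andP[a1 a2] _]] /andP[/andP[b1 b2] _].
  have /= := H1 (r, q.2); rewrite subrr normr0 subr0 => /(_ d10 b1); rewrite ltr_norml => /andP[k1 _].
  have /= := H2' (- r, q.2); rewrite subrr normr0 subr0 => /(_ d20 b2); rewrite ltr_norml => /andP[_ k2].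
  move: a1 a2; rewrite !ltr_norml => /andP[a1 a1'] /andP[a2 a2'].
  have rr : - r <= r by lra.
  have Dc : {within `[- r, r], continuous (fun x => Phi x q.2)}.
    apply: derivable_within_continuous => z; rewrite in_itv /= => /andP[z1 z2].
    apply: ex_derive; apply: (C2k_derive1 (p := (z, q.2)) (C 1%N)); split => //=.
    by apply: le_lt_trans re; rewrite (gtr0_norm r0) ler_norml z1 z2.
  have [|c] := IVT (v := q.1) rr Dc.
    rewrite ge_min le_max; apply/andP; split; apply/orP; [left|right]; lra.
  rewrite in_itv /= => /andP[c1 c2] Ec; exists c => //.
  by apply: le_lt_trans re; rewrite (gtr0_norm r0) ler_norml c1 c2.
exists (slice_inv Phi e).
  by exists d => // n; exact: slice_inv_C2k C pos de ex n.
split.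
- by rewrite -{1}P0 slice_invK.
- by exists d => // u v /(slice_invP ex)[].
- by exists e => // u v [/= a b]; exact: slice_invK.
Qed.

End ImplicitGerm.

(** * Germs of smooth functions *)

Section Germs.
Variable R : realType.
Implicit Types (f g W : R -> R -> R) (P Q : R -> R -> Prop).
Local Notation S := (@smooth2_germ R).

(** Validity near the origin, with the same quantifiers as in [diffeo_germ] and in the theorem, so
    that those clauses are instances of [loc] by unfolding. *)
Definition loc P := exists2 e : R, 0 < e & forall u v, sq e (u, v) -> P u v.

Lemma locI P Q : loc P -> loc Q -> loc (fun u v => P u v /\ Q u v).
Proof.
move=> [a a0 HP] [b b0 HQ]; exists (Num.min a b); first by rewrite lt_min a0.
move=> u v [] /=; rewrite !lt_min => /andP[? ?] /andP[? ?].
by split; [apply: HP|apply: HQ]; split.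
Qed.

Lemma locW P Q : (forall u v, P u v -> Q u v) -> loc P -> loc Q.
Proof. by move=> PQ [a a0 HP]; exists a => // u v /HP/PQ. Qed.

Lemma locT P : (forall u v, P u v) -> loc P.
Proof. by move=> H; exists 1. Qed.

Lemma loc0 P : loc P -> P 0 0.
Proof. by move=> [a a0]; apply; split; rewrite /= normr0. Qed.

Lemma locS2 P Q T : (forall u v, P u v -> Q u v -> T u v) -> loc P -> loc Q -> loc T.
Proof. by move=> H hP hQ; apply: locW (locI hP hQ) => u v [/H]. Qed.

Lemma locS3 P Q T T' : (forall u v, P u v -> Q u v -> T u v -> T' u v) ->
  loc P -> loc Q -> loc T -> loc T'.
Proof. by move=> H hP hQ hT; apply: locS2 (locI hP hQ) hT => u v [/H]. Qed.

Lemma loc_swap P : loc P -> loc (fun u v => P v u).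
Proof. by move=> [a a0 H]; exists a => // u v [? ?]; apply: H; split. Qed.

Lemma loc_axis1 P : loc P -> loc (fun u _ => P u 0).
Proof.
by move=> [a a0 H]; exists a => // u v [? ?]; apply: H; split; rewrite //= normr0.
Qed.

Lemma loc_axis2 P : loc P -> loc (fun _ v => P 0 v).
Proof.
by move=> [a a0 H]; exists a => // u v [? ?]; apply: H; split; rewrite //= normr0.
Qed.

Lemma smooth_continuous0 f : S f -> {for (0, 0), continuous (fun q => f q.1 q.2)}.
Proof. by move=> [a a0 /(_ 0%N)]; apply; split; rewrite /= normr0. Qed.

Lemma sq_nbhs (a : R) : 0 < a -> nbhs ((0, 0) : R * R) (sq a).
Proof.
move=> a0; apply: open_nbhs_nbhs; split; first exact: sq_open.
by split; rewrite /= normr0.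
Qed.

Lemma nbhs_loc (P : set (R * R)) : nbhs ((0, 0) : R * R) P -> loc (fun u v => P (u, v)).
Proof.
move=> /nbhs_boxP[a a0 H]; exists a => // u v [/= ? ?].
by apply: H; rewrite /= subr0.
Qed.

Lemma loc_comp P g1 g2 : S g1 -> S g2 -> g1 0 0 = 0 -> g2 0 0 = 0 -> loc P ->
  loc (fun u v => P (g1 u v) (g2 u v)).
Proof.
move=> S1 S2 z1 z2 [a a0 H].
have c : {for (0, 0), continuous (fun q : R * R => (g1 q.1 q.2, g2 q.1 q.2))}.
  by apply: continuous_pair; exact: smooth_continuous0.
have /nbhs_loc : nbhs ((0, 0) : R * R)
    ((fun q : R * R => (g1 q.1 q.2, g2 q.1 q.2)) @^-1` (sq a)).
  by apply: c; rewrite /= z1 z2; exact: sq_nbhs.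
by apply: locW => u v /H.
Qed.

Lemma loc_gt0 f : S f -> 0 < f 0 0 -> loc (fun u v => 0 < f u v).
Proof.
move=> Sf f0; have /cvgP_box/(_ _ f0)[a a0 H] := smooth_continuous0 Sf.
exists a => // u v [/= au av]; have /= := H (u, v); rewrite !subr0 => /(_ au av).
by rewrite ltr_norml => /andP[+ _]; lra.
Qed.

Lemma loc_neq0 f : S f -> f 0 0 != 0 -> loc (fun u v => f u v != 0).
Proof.
move=> Sf f0; have fn0 : 0 < `|f 0 0| by rewrite normr_gt0.
have /cvgP_box/(_ _ fn0)[a a0 H] := smooth_continuous0 Sf.
exists a => // u v [/= au av]; have /= := H (u, v); rewrite !subr0 => /(_ au av).
by case: eqP => // ->; rewrite sub0r normrN ltxx.
Qed.

Lemma smooth_on f g : S f -> S g ->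
  exists2 e : R, 0 < e & forall n, C2k n (sq e) f /\ C2k n (sq e) g.
Proof.
move=> [a a0 Ca] [b b0 Cb]; exists (Num.min a b); first by rewrite lt_min a0.
move=> n; split; [apply: C2k_sub (Ca n)|apply: C2k_sub (Cb n)] => q [];
  by rewrite !lt_min => /andP[? ?] /andP[? ?]; split.
Qed.

Lemma smooth_on_loc f P : S f -> loc P ->
  exists2 e : R, 0 < e & (forall n, C2k n (sq e) f) /\ forall q, sq e q -> P q.1 q.2.
Proof.
move=> [a a0 Ca] [b b0 Cb]; exists (Num.min a b); first by rewrite lt_min a0.
split=> [n|q [] /=].
  apply: C2k_sub (Ca n) => q []; by rewrite !lt_min => /andP[? ?] /andP[? ?]; split.
by rewrite !lt_min => /andP[? ?] /andP[? ?]; apply: Cb; split.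
Qed.

(** * Closure properties of smooth germs *)

Lemma smooth_cst (c : R) : S (fun _ _ => c).
Proof. by exists 1 => // n; apply: C2k_cst; exact: sq_open. Qed.

Lemma smooth_fst : S (fun x _ => x).
Proof. by exists 1 => // n; apply: C2k_fst; exact: sq_open. Qed.

Lemma smooth_snd : S (fun _ y => y).
Proof. by exists 1 => // n; apply: C2k_snd; exact: sq_open. Qed.

Lemma smooth_add f g : S f -> S g -> S (fun x y => f x y + g x y).
Proof.
move=> Sf Sg; have [e e0 H] := smooth_on Sf Sg; exists e => // n.
by have [? ?] := H n; apply: C2k_add => //; exact: sq_open.
Qed.

Lemma smooth_mul f g : S f -> S g -> S (fun x y => f x y * g x y).
Proof.
move=> Sf Sg; have [e e0 H] := smooth_on Sf Sg; exists e => // n.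
by have [? ?] := H n; apply: C2k_mul => //; exact: sq_open.
Qed.

Lemma smooth_opp f : S f -> S (fun x y => - f x y).
Proof. by move=> [e e0 H]; exists e => // n; apply: C2k_opp => //; exact: sq_open. Qed.

Lemma smooth_sub f g : S f -> S g -> S (fun x y => f x y - g x y).
Proof. by move=> Sf Sg; apply: smooth_add => //; exact: smooth_opp. Qed.

Lemma smooth_exp f m : S f -> S (fun x y => f x y ^+ m).
Proof. by move=> [e e0 H]; exists e => // n; apply: C2k_exp => //; exact: sq_open. Qed.

Lemma smooth_inv f : S f -> f 0 0 != 0 -> S (fun x y => (f x y)^-1).
Proof.
move=> Sf /(loc_neq0 Sf) H; have [e e0 [C N]] := smooth_on_loc Sf H.
by exists e => // n; apply: C2k_inv => //; exact: sq_open.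
Qed.

Lemma smooth_sqrt f : S f -> 0 < f 0 0 -> S (fun x y => Num.sqrt (f x y)).
Proof.
move=> Sf /(loc_gt0 Sf) H; have [e e0 [C N]] := smooth_on_loc Sf H.
by exists e => // n; apply: C2k_sqrt => //; exact: sq_open.
Qed.

Lemma smooth_sum n (F : 'I_n -> R -> R -> R) (c : 'I_n -> R) : (forall i, S (F i)) ->
  S (fun x y => \sum_(i < n) c i * F i x y).
Proof.
elim: n F c => [|n IH] F c SF.
  have := smooth_cst 0; congr S; apply/funext => x; apply/funext => y.
  by rewrite big_ord0.
have := smooth_add (smooth_mul (smooth_cst (c ord0)) (SF ord0))
  (IH (fun i => F (lift ord0 i)) (fun i => c (lift ord0 i)) (fun i => SF _)).
by congr S; apply/funext => x; apply/funext => y; rewrite big_ord_recl.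
Qed.

Lemma smooth_comp f g1 g2 : S f -> S g1 -> S g2 -> g1 0 0 = 0 -> g2 0 0 = 0 ->
  S (fun x y => f (g1 x y) (g2 x y)).
Proof.
move=> [a a0 Cf] S1 S2 z1 z2.
have /(loc_comp S1 S2 z1 z2) L : loc (fun u v => sq a (u, v)) by exists a.
have [b b0 [C1 Q]] := smooth_on_loc S1 L.
have [c c0 C2] := S2.
exists (Num.min b c); first by rewrite lt_min b0.
have sb : sq (Num.min b c) `<=` sq b.
  by move=> q []; rewrite !lt_min => /andP[? ?] /andP[? ?]; split.
have sc : sq (Num.min b c) `<=` sq c.
  by move=> q []; rewrite !lt_min => /andP[? ?] /andP[? ?]; split.
move=> n; apply: (@C2k_comp _ _ (sq a)) => //; try exact: sq_open.
- by move=> p /sb/Q.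
- exact: C2k_sub (C1 n).
- exact: C2k_sub (C2 n).
Qed.

Lemma smooth_pu f : S f -> S (pu f).
Proof. by move=> [e e0 H]; exists e => // n; have [_ []] := H n.+1. Qed.

Lemma smooth_swap f : S f -> S (fun x y => f y x).
Proof. by move=> Sf; exact: (smooth_comp Sf smooth_snd smooth_fst). Qed.

Lemma smooth_axis1 f : S f -> S (fun x _ => f x 0).
Proof. by move=> Sf; exact: (smooth_comp Sf smooth_fst (smooth_cst 0)). Qed.

Lemma smooth_axis2 f : S f -> S (fun _ y => f 0 y).
Proof. by move=> Sf; exact: (smooth_comp Sf (smooth_cst 0) smooth_snd). Qed.

(** Germs of one variable are carried through the proof as germs of two variables restricted to
    [v = 0]; this returns to one variable at the end. *)
Lemma smooth1_axis f : S f -> smooth1_germ (fun x => f x 0).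
Proof.
move=> [e e0 H]; exists e => // n; move: {H}(H n); elim: n f => [|n IH] f /=.
  move=> C x xe.
  apply: (@continuous_comp _ _ _ (fun x : R => (x, 0)) (fun q => f q.1 q.2)).
    by apply: continuous_pair; [exact: cvg_id|exact: cvg_cst].
  by apply: C; split => //=; rewrite normr0.
move=> [D [Cu Cv]]; split; last exact: (IH (pu f)).
move=> x xe; have Sx : sq e (x, 0) by split => //=; rewrite normr0.
exact: (D _ Sx).1.
Qed.

(** * Partial derivatives of germs and the chain rule *)

Lemma smooth_derive1 f : S f ->
  loc (fun u v => is_derive u 1 (fun x => f x v) (pu f u v)).
Proof. by move=> [e e0 /(_ 1%N) C]; exists e => // u v /(C2k_derive1 C). Qed.

Lemma smooth_derive2 f : S f ->
  loc (fun u v => is_derive v 1 (fun y => f u y) (pv f u v)).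
Proof. by move=> [e e0 /(_ 1%N) C]; exists e => // u v /(C2k_derive2 C). Qed.

Lemma loc_eq_pu f g : loc (fun u v => f u v = g u v) -> loc (fun u v => pu f u v = pu g u v).
Proof.
move=> [e e0 H]; exists e => // u v Suv.
by apply: (@eq_pu _ (sq e) f g (u, v)) => //; [exact: sq_open|move=> [? ?] /H].
Qed.

Lemma loc_eq_pv f g : loc (fun u v => f u v = g u v) -> loc (fun u v => pv f u v = pv g u v).
Proof.
move=> [e e0 H]; exists e => // u v Suv.
by apply: (@eq_pv _ (sq e) f g (u, v)) => //; [exact: sq_open|move=> [? ?] /H].
Qed.

Lemma pu_comp f g1 g2 : S f -> S g1 -> S g2 -> g1 0 0 = 0 -> g2 0 0 = 0 ->
  loc (fun u v => pu (fun x y => f (g1 x y) (g2 x y)) u v =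
    pu f (g1 u v) (g2 u v) * pu g1 u v + pv f (g1 u v) (g2 u v) * pu g2 u v).
Proof.
move=> [a a0 Cf] S1 S2 z1 z2.
have /(loc_comp S1 S2 z1 z2) L : loc (fun u v => sq a (u, v)) by exists a.
apply: locS3 L (smooth_derive1 S1) (smooth_derive1 S2) => u v Sg D1 D2.
apply: (proj2 (is_derive_puP _)).
exact: (@chain_rule R _ f (fun x => g1 x v) (fun x => g2 x v) u _ _ (@sq_open R a) (Cf 1%N) Sg D1 D2).
Qed.

Lemma pv_comp f g1 g2 : S f -> S g1 -> S g2 -> g1 0 0 = 0 -> g2 0 0 = 0 ->
  loc (fun u v => pv (fun x y => f (g1 x y) (g2 x y)) u v =
    pu f (g1 u v) (g2 u v) * pv g1 u v + pv f (g1 u v) (g2 u v) * pv g2 u v).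
Proof.
move=> [a a0 Cf] S1 S2 z1 z2.
have /(loc_comp S1 S2 z1 z2) L : loc (fun u v => sq a (u, v)) by exists a.
apply: locS3 L (smooth_derive2 S1) (smooth_derive2 S2) => u v Sg D1 D2.
apply: (proj2 (is_derive_pvP _)).
exact: (@chain_rule R _ f (fun y => g1 u y) (fun y => g2 u y) v _ _ (@sq_open R a) (Cf 1%N) Sg D1 D2).
Qed.

(** * Division by powers of a variable and Hadamard's lemma *)

Lemma division_germ k W f : S W -> S f ->
  loc (fun u v => pu W u v = u ^+ k * f u v) -> loc (fun _ v => W 0 v = 0) ->
  exists g, [/\ S g, loc (fun u v => W u v = u ^+ k.+1 * g u v) & g 0 0 = f 0 0 / k.+1%:R].
Proof.
move=> SW Sf L1 L2; have [e e0 [CW H]] := smooth_on_loc SW (locI L1 L2).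
have [e' e'0 Cf] := Sf.
have D : divisible (Num.min e e') k W f.
  have sb : sq (Num.min e e') `<=` @sq R e.
    by move=> q []; rewrite !lt_min => /andP[? ?] /andP[? ?]; split.
  have sc : sq (Num.min e e') `<=` @sq R e'.
    by move=> q []; rewrite !lt_min => /andP[? ?] /andP[? ?]; split.
  by split=> [m|m|q /sb/H[]|q /sb/H[]] //; [exact: C2k_sub (CW m)|exact: C2k_sub (Cf m)].
exists (divu k W f); split.
- by exists (Num.min e e') => [|n]; [rewrite lt_min e0|exact: divu_C2k].
- by apply: locW L2 => u v W0; exact: divu_mul.
- by rewrite /divu eqxx.
Qed.

Lemma hadamard W : S W -> loc (fun _ v => W 0 v = 0) ->
  exists g, [/\ S g, loc (fun u v => W u v = u * g u v) & g 0 0 = pu W 0 0].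
Proof.
move=> SW W0; have [|g [Sg E g0]] := @division_germ 0 W (pu W) SW (smooth_pu SW) _ W0.
  by apply: locT => u v; rewrite expr0 mul1r.
by exists g; split; [exact: Sg|exact: E|rewrite g0 divr1].
Qed.

(** Hadamard's lemma gives [pu W = u * f], and [division_germ] with [k = 1] then divides [W] itself
    by [u ^+ 2]. *)
Lemma hadamard2 W : S W -> loc (fun _ v => W 0 v = 0) -> loc (fun _ v => pu W 0 v = 0) ->
  exists2 g, S g & loc (fun u v => W u v = u ^+ 2 * g u v).
Proof.
move=> SW W0 W1; have [f [Sf E _]] := hadamard (smooth_pu SW) W1.
by have [//|g [Sg Eg _]] := @division_germ 1 W f SW Sf _ W0; exists g.
Qed.

(** Off the axis [v = 0] the factor cancels; on it, differentiating the identity in [v] leaves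
    [h u 0 = 0]. *)
Lemma loc_mulv_eq0 h : S h -> loc (fun u v => v * h u v = 0) -> loc (fun u v => h u v = 0).
Proof.
move=> Sh L; apply: locS3 (smooth_derive2 Sh) L (loc_eq_pv L) => u v D E Ev.
have [v0|v0] := eqVneq v 0; last by move/eqP : E; rewrite mulf_eq0 (negPf v0) => /eqP.
have : pv (fun u v => v * h u v) u v = v * pv h u v + h u v * 1.
  apply: (proj2 (is_derive_pvP _)); apply: is_derive_mulf D; exact: is_derive_id.
rewrite Ev v0 mul0r add0r mulr1 => <-.
by apply: (proj2 (is_derive_pvP _)); exact: is_derive_cst.
Qed.

End Germs.

(** * Split germs and adapted coordinates *)

Section Forms.
Variable R : realType.
Implicit Types (f g W : R -> R -> R).
Local Notation S := (@smooth2_germ R).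
Local Notation loc := (@loc R).

(** * Composition, exchange and Jacobian of coordinate changes *)

Lemma diffeo_comp (s1 s2 t1 t2 s1' s2' t1' t2' : R -> R -> R) :
  diffeo_germ s1 s2 t1 t2 -> diffeo_germ s1' s2' t1' t2' ->
  diffeo_germ (fun u v => s1' (s1 u v) (s2 u v)) (fun u v => s2' (s1 u v) (s2 u v))
              (fun u v => t1 (t1' u v) (t2' u v)) (fun u v => t2 (t1' u v) (t2' u v)).
Proof.
move=> [[S1 S2] [T1 T2] [[s10 s20] [t10 t20]] ts st].
move=> [[S1' S2'] [T1' T2'] [[s10' s20'] [t10' t20']] ts' st'].
split.
- by split; apply: smooth_comp.
- by split; apply: smooth_comp.
- by rewrite s10 s20 s10' s20' t10' t20' t10 t20.
- have L := loc_comp S1 S2 s10 s20 ts'.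
  by apply: locS2 ts L => u v [E1 E2] [-> ->].
- have L := loc_comp T1' T2' t10' t20' st.
  by apply: locS2 st' L => u v [E1 E2] [-> ->].
Qed.

Lemma diffeo_swap : diffeo_germ (fun _ y => y) (fun x _ => x) (fun _ y => y) (fun x _ => x : R).
Proof.
have H1 := smooth_fst R; have H2 := smooth_snd R.
by split=> //; apply: locT.
Qed.

Definition jac (s1 s2 : R -> R -> R) : R :=
  pu s1 0 0 * pv s2 0 0 - pv s1 0 0 * pu s2 0 0.

Lemma jac_comp (s1 s2 h1 h2 : R -> R -> R) : S s1 -> S s2 -> S h1 -> S h2 ->
  h1 0 0 = 0 -> h2 0 0 = 0 ->
  jac (fun u v => s1 (h1 u v) (h2 u v)) (fun u v => s2 (h1 u v) (h2 u v)) =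
  jac s1 s2 * jac h1 h2.
Proof.
move=> S1 S2 H1 H2 z1 z2; rewrite /jac.
rewrite (loc0 (pu_comp S1 H1 H2 z1 z2)) (loc0 (pu_comp S2 H1 H2 z1 z2)).
rewrite (loc0 (pv_comp S1 H1 H2 z1 z2)) (loc0 (pv_comp S2 H1 H2 z1 z2)) z1 z2.
move: (pu s1 _ _) (pv s1 _ _) (pu s2 _ _) (pv s2 _ _).
by move: (pu _ _ _) (pv _ _ _) (pu _ _ _) (pv _ _ _) => *; ring.
Qed.

Lemma pu_fst (u v : R) : pu (fun x _ : R => x) u v = 1.
Proof. by apply: (proj2 (is_derive_puP _)); exact: is_derive_id. Qed.
Lemma pv_fst (u v : R) : pv (fun x _ : R => x) u v = 0.
Proof. by apply: (proj2 (is_derive_pvP _)); exact: is_derive_cst. Qed.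
Lemma pu_snd (u v : R) : pu (fun _ y : R => y) u v = 0.
Proof. by apply: (proj2 (is_derive_puP _)); exact: is_derive_cst. Qed.
Lemma pv_snd (u v : R) : pv (fun _ y : R => y) u v = 1.
Proof. by apply: (proj2 (is_derive_pvP _)); exact: is_derive_id. Qed.

(** The chain rule at the origin, applied to the identity written as [t] after [s]. *)
Lemma diffeo_jac_neq0 (s1 s2 t1 t2 : R -> R -> R) : diffeo_germ s1 s2 t1 t2 ->
  jac s1 s2 != 0.
Proof.
move=> [[S1 S2] [T1 T2] [[s10 s20] [t10 t20]] ts _].
have E := jac_comp T1 T2 S1 S2 s10 s20.
have E1 : jac (fun u v => t1 (s1 u v) (s2 u v)) (fun u v => t2 (s1 u v) (s2 u v)) = 1.
  have L1 : loc (fun u v => t1 (s1 u v) (s2 u v) = u) by apply: locW ts => u v [].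
  have L2 : loc (fun u v => t2 (s1 u v) (s2 u v) = v) by apply: locW ts => u v [].
  rewrite /jac (loc0 (loc_eq_pu L1)) (loc0 (loc_eq_pu L2)).
  rewrite (loc0 (loc_eq_pv L1)) (loc0 (loc_eq_pv L2)).
  by rewrite pu_fst pv_fst pu_snd pv_snd !mulr1 mul0r subr0.
by apply/eqP => J0; move: E; rewrite E1 J0 mulr0 => /eqP; rewrite oner_eq0.
Qed.

Definition split_form g (al be ch : R -> R -> R) :=
  [/\ S al, S be, S ch &
      loc (fun u v => g u v = u ^+ 2 * al u 0 + v ^+ 2 * be v 0 + u ^+ 2 * v ^+ 2 * ch u v)].

(** Lets the normalisation of a positive coefficient of [u ^+ 2] be reused for a negative
    coefficient of [v ^+ 2]. *)
Lemma split_form_swap_opp g al be ch : split_form g al be ch ->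
  split_form (fun u v => - g v u) (fun u v => - be u v) (fun u v => - al u v) (fun u v => - ch v u).
Proof.
move=> [Sa Sb Sc E]; split; [exact: smooth_opp|exact: smooth_opp| |].
  exact/smooth_opp/smooth_swap.
by apply: locW (loc_swap E) => u v ->; ring.
Qed.

Lemma is_derive_subf (f g : R -> R) (x a b : R) : is_derive x 1 f a -> is_derive x 1 g b ->
  is_derive x 1 (fun z => f z - g z) (a - b).
Proof. exact: is_deriveB. Qed.

Lemma is_derive_addf (f g : R -> R) (x a b : R) : is_derive x 1 f a -> is_derive x 1 g b ->
  is_derive x 1 (fun z => f z + g z) (a + b).
Proof. exact: is_deriveD. Qed.

Lemma pu_val f (u v l l' : R) : is_derive u 1 (fun x => f x v) l -> l = l' -> pu f u v = l'.
Proof. by move=> D <-; exact: (is_derive_puP D).2. Qed.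

Lemma pv_val f (u v l l' : R) : is_derive v 1 (fun y => f u y) l -> l = l' -> pv f u v = l'.
Proof. by move=> D <-; exact: (is_derive_pvP D).2. Qed.

(** Division on the two axes gives [al] and [be]. The rest [K] has [v]-derivative
    [v * (f2 u v - f2 0 v)], so [K = v ^+ 2 * M]; as [K] and [pu K] vanish on [u = 0], so do [M] and
    [pu M], and [hadamard2] extracts [u ^+ 2]. *)
Lemma split_form_of_partials G f1 f2 : S G -> S f1 -> S f2 -> G 0 0 = 0 ->
  loc (fun u v => pu G u v = u * f1 u v) -> loc (fun u v => pv G u v = v * f2 u v) ->
  exists al be ch, [/\ split_form G al be ch, al 0 0 = f1 0 0 / 2 & be 0 0 = f2 0 0 / 2].
Proof.
move=> SG S1 S2 G0 Lu Lv.
have [||al [Sal Eal al0]] :=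
    @division_germ _ 1 (fun u _ => G u 0) (fun u _ => f1 u 0) (smooth_axis1 SG) (smooth_axis1 S1).
- by apply: locW (loc_axis1 Lu) => u v E; rewrite expr1; exact: E.
- by apply: locT.
have [||be [Sbe Ebe be0]] := @division_germ _ 1 (fun u _ => G 0 u) (fun u _ => f2 0 u)
   (smooth_swap (smooth_axis2 SG)) (smooth_swap (smooth_axis2 S2)).
- by apply: locW (loc_swap (loc_axis2 Lv)) => u v E; rewrite expr1; exact: E.
- by apply: locT.
pose K u v := G u v - G u 0 - G 0 v.
have SK : S K by apply: smooth_sub; [apply: smooth_sub => //; exact: smooth_axis1|exact: smooth_axis2].
have Sf : S (fun u v => f2 u v - f2 0 v) by apply: smooth_sub => //; exact: smooth_axis2.
have [||L [SL EL _]] := @division_germ _ 1 (fun v u => K u v)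
    (fun v u => f2 u v - f2 0 v) (smooth_swap SK) (smooth_swap Sf).
- have D0 := smooth_derive2 (smooth_axis2 SG).
  apply: loc_swap; apply: locS2 (locI Lv (loc_axis2 Lv)) (locI (smooth_derive2 SG) D0).
  move=> u v [E1 E2] [D1 D2].
  apply: (proj2 (is_derive_puP _)); rewrite expr1 mulrBr -E1 -E2.
  have -> : pv G u v - pv G 0 v = pv G u v - 0 - pv G 0 v by rewrite subr0.
  exact: (is_deriveB (is_deriveB D1 (is_derive_cst (G u 0) _ _)) D2).
- by apply: locT => u v; rewrite /K G0 subr0 subrr.
pose M u v := L v u.
have SM : S M by exact: smooth_swap.
have EM : loc (fun u v => K u v = v * (v * M u v)).
  by apply: locW (loc_swap EL) => u v ->; rewrite expr2 mulrA.
have M0 : loc (fun _ v => M 0 v = 0).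
  apply: (loc_mulv_eq0 (smooth_axis2 SM)).
  apply: (@loc_mulv_eq0 _ (fun _ v => v * M 0 v)).
    by apply: smooth_mul; [exact: smooth_snd|exact: smooth_axis2].
  by apply: locW (loc_axis2 EM) => _ v <-; rewrite /K G0 subr0 subrr.
(* On [u = 0] the derivative [pu K] is a difference of two values of [u * f1], hence zero;
   cancelling [v] twice transfers this to [M]. *)
have M1 : loc (fun _ v => pu M 0 v = 0).
  apply: (loc_mulv_eq0 (smooth_axis2 (smooth_pu SM))).
  apply: (@loc_mulv_eq0 _ (fun _ v => v * pu M 0 v)).
    by apply: smooth_mul; [exact: smooth_snd|exact/smooth_axis2/smooth_pu].
  have D1 := loc_axis2 (smooth_derive1 SG).
  have D2 := loc_axis2 (smooth_derive1 (smooth_axis1 SG)).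
  have DM := loc_axis2 (smooth_derive1 SM).
  have E1 := loc_axis2 Lu.
  have E2 := loc_axis2 (loc_axis1 Lu).
  apply: locS3 (loc_axis2 (loc_eq_pu EM)) (locI E1 E2) (locI (locI D1 D2) DM).
  move=> _ v E [e1 e2] [[d1 d2] dM].
  have P1 : pu K 0 v = pu G 0 v - pu G 0 0 - 0.
    have d2' : is_derive (0 : R) 1 (fun x => G x 0) (pu G 0 0) by exact: d2.
    have d3 : is_derive (0 : R) 1 (fun _ : R => G 0 v) 0 by exact: is_derive_cst.
    exact: (proj2 (is_derive_puP (f := K) (is_derive_subf (is_derive_subf d1 d2') d3))).
  have P2 : pu (fun u v => v * (v * M u v)) 0 v = v * (v * pu M 0 v).
    exact: (proj2 (is_derive_puP (f := fun u v => v * (v * M u v)) (is_deriveZ v (is_deriveZ v dM)))).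
  by rewrite -P2 -E P1 e1 e2 !mul0r !subr0.
have [ch Sch Ech] := hadamard2 SM M0 M1.
exists al, be, ch; split => //; split => //.
apply: locS3 (locI Eal (loc_swap Ebe)) EM (locI Ech (locI (loc_axis1 Eal) (loc_swap (loc_axis1 Ebe)))).
move=> u v [_ _] EKM [EMc [<- <-]].
by rewrite -mulrA [_ ^+ 2 * (_ * _)]mulrCA -EMc expr2 -mulrA -EKM /K; ring.
Qed.

(** Flatness to first order only. It singles out the smooth germs [al(u) + v^2 ch(u, v)] in a form
    that passes easily to products, inverses, square roots and composites. *)
Definition flat f := loc (fun u _ => pv f u 0 = 0).

Lemma flat_remainder f (al ch : R -> R -> R) : S ch ->
  loc (fun u v => f u v = al u 0 + v ^+ 2 * ch u v) -> flat f.
Proof.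
move=> Sc E; apply: locS2 (loc_axis1 (loc_eq_pv E)) (loc_axis1 (smooth_derive2 Sc)).
move=> u _ -> D.
have D2 := is_derive_mulf (is_deriveXn 1 (0 : R)) D.
have D1 : is_derive (0 : R) 1 (fun _ : R => al u 0) 0 by exact: is_derive_cst.
apply: (pv_val (f := fun u v => al u 0 + v ^+ 2 * ch u v) (is_derive_addf D1 D2)).
by rewrite expr0n mul0r !mulr0 !addr0.
Qed.

Lemma flat_mul f g : S f -> S g -> flat f -> flat g -> flat (fun u v => f u v * g u v).
Proof.
move=> Sf Sg Ff Fg.
apply: locS2 (locI Ff Fg) (locI (loc_axis1 (smooth_derive2 Sf)) (loc_axis1 (smooth_derive2 Sg))).
move=> u _ [E1 E2] [D1 D2].
apply: (pv_val (f := fun u v => f u v * g u v) (is_derive_mulf D1 D2)).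
by rewrite E1 E2 !mulr0 addr0.
Qed.

Lemma flat_inv f : S f -> f 0 0 != 0 -> flat f -> flat (fun u v => (f u v)^-1).
Proof.
move=> Sf f0 Ff; have N := loc_axis1 (loc_neq0 Sf f0).
apply: locS3 Ff N (loc_axis1 (smooth_derive2 Sf)) => u _ E N0 D.
apply: (pv_val (f := fun u v => (f u v)^-1) (is_derive_invf N0 D)).
by rewrite E mulr0.
Qed.

Lemma flat_sqrt f : S f -> 0 < f 0 0 -> flat f -> flat (fun u v => Num.sqrt (f u v)).
Proof.
move=> Sf f0 Ff; have N := loc_axis1 (loc_gt0 Sf f0).
apply: locS3 Ff N (loc_axis1 (smooth_derive2 Sf)) => u _ E N0 D.
apply: (pv_val (f := fun u v => Num.sqrt (f u v)) (is_derive1_comp (is_derive1_sqrt N0) D)).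
by rewrite E mulr0.
Qed.

Lemma flat_fst : flat (fun u _ : R => u).
Proof. by apply: locT => u v; rewrite pv_fst. Qed.

Lemma pv_comp_snd f (xi : R -> R -> R) : S f -> S xi -> xi 0 0 = 0 ->
  loc (fun u v => pv (fun u v => f (xi u v) v) u v =
                  pu f (xi u v) v * pv xi u v + pv f (xi u v) v).
Proof.
move=> Sf Sx x0; apply: locW (pv_comp Sf Sx (smooth_snd R) x0 erefl) => u v.
by rewrite pv_snd mulr1.
Qed.

Lemma flat_comp f (xi : R -> R -> R) : S f -> S xi -> xi 0 0 = 0 -> flat f -> flat xi ->
  flat (fun u v => f (xi u v) v).
Proof.
move=> Sf Sx x0 Ff Fx.
have Ffx := loc_comp (smooth_axis1 Sx) (smooth_cst 0) x0 erefl Ff.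
apply: locS3 (loc_axis1 (pv_comp_snd Sf Sx x0)) Fx Ffx => u _ /= -> -> ->.
by rewrite mulr0 addr0.
Qed.

(** Differentiating [Phi (xi u v) v = u] in [v] on [v = 0] leaves [pu Phi * pv xi = 0], with
    [pu Phi] positive. *)
Lemma flat_inverse (Phi xi : R -> R -> R) : S Phi -> S xi -> xi 0 0 = 0 -> 0 < pu Phi 0 0 ->
  loc (fun u v => Phi (xi u v) v = u) -> flat Phi -> flat xi.
Proof.
move=> SP Sx x0 P0 E FP.
have FPx := loc_comp (smooth_axis1 Sx) (smooth_cst 0) x0 erefl FP.
have pos := loc_axis1 (loc_comp Sx (smooth_snd R) x0 erefl (loc_gt0 (smooth_pu SP) P0)).
apply: locS3 (loc_axis1 (pv_comp_snd SP Sx x0)) (locI pos FPx) (loc_axis1 (loc_eq_pv E)).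
move=> u _ /= E1 [p E2]; rewrite E1 E2 addr0 pv_fst => /eqP.
by rewrite mulf_eq0 (gt_eqF p) => /eqP.
Qed.

(** A split germ is [u^2 M + v^2 be(v)] with [M = al(u) + v^2 ch(u, v)]. The new coordinate
    [u sqrt(M0)] turns the given germ into [u^2 + v^2 be0(v)], and any other one into
    [u^2 q(xi, v) + v^2 be(v)] with [q = M / M0]. Since [q] and [xi] are flat, the factor [q(xi, v)]
    splits again. *)
Lemma normalize_first g0 al0 be0 ch0 : split_form g0 al0 be0 ch0 -> 0 < al0 0 0 ->
  exists Phi xi, [/\ diffeo_germ Phi (fun _ y => y) xi (fun _ y => y),
    loc (fun u v => g0 (xi u v) v = u ^+ 2 + v ^+ 2 * be0 v 0) &
    forall g al be ch, split_form g al be ch ->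
    exists al' ch', split_form (fun u v => g (xi u v) v) al' be ch' /\
      al' 0 0 = al 0 0 / al0 0 0].
Proof.
move=> [Sa0 Sb0 Sc0 E0] a0.
pose M (al ch : R -> R -> R) u v := al u 0 + v ^+ 2 * ch u v.
have SM al ch : S al -> S ch -> S (M al ch).
  move=> Sa Sc; apply: smooth_add; first exact: smooth_axis1.
  by apply: smooth_mul => //; apply: smooth_exp; exact: smooth_snd.
have FM al ch : S ch -> flat (M al ch).
  by move=> Sc; apply: (@flat_remainder _ al ch Sc); apply: locT.
have M00 al ch : M al ch 0 0 = al 0 0 by rewrite /M expr0n mul0r addr0.
pose M0 := M al0 ch0.
have SM0 : S M0 by exact: SM.
have M0p : 0 < M0 0 0 by rewrite /M0 M00.
have Sr := smooth_sqrt SM0 M0p.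
pose Phi u v := u * Num.sqrt (M0 u v).
have SP : S Phi by apply: smooth_mul => //; exact: smooth_fst.
have FP : flat Phi.
  apply: flat_mul => //; [exact: smooth_fst|exact: flat_fst|].
  by apply: flat_sqrt => //; exact: FM.
have P0 : Phi 0 0 = 0 by rewrite /Phi mul0r.
have Pu : 0 < pu Phi 0 0.
  have -> : pu Phi 0 0 = 0 * pu (fun u v => Num.sqrt (M0 u v)) 0 0 + Num.sqrt (M0 0 0) * 1.
    have D1 : is_derive (0 : R) 1 (fun x : R => x) 1 by exact: is_derive_id.
    exact: (pu_val (f := Phi) (is_derive_mulf D1 (loc0 (smooth_derive1 Sr)))).
  by rewrite mul0r add0r mulr1 sqrtr_gt0.
have [xi Sx [x0 Ex Ex']] := implicit_germ SP P0 Pu.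
have Fx := flat_inverse SP Sx x0 Pu Ex FP.
have M0x := loc_comp Sx (smooth_snd R) x0 erefl (loc_gt0 SM0 M0p).
have X2 : loc (fun u v => xi u v ^+ 2 * M0 (xi u v) v = u ^+ 2).
  by apply: locS2 Ex M0x => u v E h; rewrite -[RHS](congr1 (fun x => x ^+ 2) E) /Phi exprMn sqr_sqrtr// ltW.
exists Phi, xi; split.
- split=> //; [by split => //; exact: smooth_snd|by split => //; exact: smooth_snd| |].
  + by apply: locW Ex'.
  + by apply: locW Ex.
- apply: locS2 X2 (loc_comp Sx (smooth_snd R) x0 erefl E0) => u v E ->.
  by rewrite -E /M0 /M; ring.
move=> g al be ch [Sa Sb Sc E].
pose q u v := M al ch u v * (M0 u v)^-1.
have M0n : M0 0 0 != 0 by rewrite gt_eqF.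
have Sq : S q by apply: smooth_mul; [exact: SM|exact: smooth_inv].
have Fq : flat q.
  apply: flat_mul; [exact: SM|exact: smooth_inv|exact: FM|].
  by apply: flat_inv => //; exact: FM.
pose al' u v := q (xi u v) v.
have Sal' : S al' by apply: (smooth_comp Sq Sx) => //; exact: smooth_snd.
have Fal' : flat al' by exact: flat_comp.
(* Flatness of [al'] permits division by [v ^+ 2]; the arguments are exchanged because [hadamard2]
   divides by the first variable. *)
have [|||ch' Sch' Ech'] := @hadamard2 _ (fun v u => al' u v - al' u 0).
- by apply: smooth_sub; [exact: smooth_swap|exact/smooth_swap/smooth_axis1].
- by apply: locT => _ v; rewrite subrr.
- have := locI Fal' (loc_axis1 (smooth_derive2 Sal')) => /loc_swap; apply: locW => _ u [Ea D].
  have D1 : is_derive (0 : R) 1 (fun _ : R => al' u 0) 0 by exact: is_derive_cst.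
  apply: (pu_val (f := fun v u => al' u v - al' u 0) (is_derive_subf D D1)).
  by rewrite Ea subr0.
exists al', (fun u v => ch' v u); split; last by rewrite /al' x0 /q /M0 !M00.
split => //; first exact: smooth_swap.
apply: locS3 X2 (locI M0x (loc_comp Sx (smooth_snd R) x0 erefl E)) (loc_swap Ech').
move=> u v Eu [Mp ->] Ec.
have -> : u ^+ 2 * al' u 0 + v ^+ 2 * be v 0 + u ^+ 2 * v ^+ 2 * ch' v u =
  u ^+ 2 * al' u v + v ^+ 2 * be v 0.
  have -> : al' u v = al' u 0 + v ^+ 2 * ch' v u by rewrite -Ec addrC subrK.
  by ring.
have -> : u ^+ 2 * al' u v = xi u v ^+ 2 * M al ch (xi u v) v.
  by rewrite -Eu /al' /q mulrCA -mulrA mulfV ?mulr1 1?mulrC// gt_eqF.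
by rewrite /M; ring.
Qed.

Lemma normalize_both g0 al0 be0 ch0 : split_form g0 al0 be0 ch0 -> 0 < al0 0 0 -> be0 0 0 < 0 ->
  exists s1 s2 t1 t2, [/\ diffeo_germ s1 s2 t1 t2,
    loc (fun u v => g0 (t1 u v) (t2 u v) = u ^+ 2 - v ^+ 2) &
    forall g al be ch, split_form g al be ch ->
    exists al' be' ch', [/\ split_form (fun u v => g (t1 u v) (t2 u v)) al' be' ch',
      al' 0 0 = al 0 0 / al0 0 0 & be' 0 0 = - (be 0 0 / be0 0 0)]].
Proof.
move=> F0 a0 b0; have [Phi [xi [D1 E1 H1]]] := normalize_first F0 a0.
have [_ Sb0 _ _] := F0.
(* Negated and with variables exchanged, the first component now has coefficient [- be0 u] at
   [u ^+ 2], positive at the origin, and [-1] at [v ^+ 2]; the first normalisation applies once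
   more. *)
have F0' : split_form (fun u v => - g0 (xi v u) u) (fun u v => - be0 u v) (fun _ _ => -1) (fun _ _ => 0).
  split; [exact: smooth_opp|exact: smooth_cst|exact: smooth_cst|].
  by apply: locW (loc_swap E1) => u v ->; ring.
have [|Psi [eta [D2 E2 H2]]] := normalize_first F0'; first by rewrite oppr_gt0.
(* The exchange before the second step is undone after it. *)
have D := diffeo_comp (diffeo_comp (diffeo_comp D1 diffeo_swap) D2) diffeo_swap.
do 2 eexists; exists (fun u v => xi u (eta v u)), (fun u v => eta v u); split.
- exact: D.
- by apply: locW (loc_swap E2) => u v E; rewrite -[LHS]opprK E; ring.
move=> g al be ch /H1[al' [ch' [/split_form_swap_opp F' al'0]]].
have [be' [ch'' [/split_form_swap_opp F'' be'0]]] := H2 _ _ _ _ F'.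
(* The double sign comes from using [split_form_swap_opp] twice. *)
exists (fun u v => - - al' u v), (fun u v => - be' u v), (fun u v => - ch'' v u).
split; last by rewrite be'0 invrN mulrNN.
  by have [? ? ? E] := F''; split => //; apply: locW E => u v <-; rewrite opprK.
by rewrite opprK.
Qed.

End Forms.

(** * Rotations of three-space *)

Section Frame.
Variable R : realType.
Implicit Types (x y z : 'I_3 -> R).

Lemma ord3_ind (P : 'I_3 -> Prop) : P 0 -> P 1 -> P 2 -> forall i, P i.
Proof.
move=> P0 P1 P2 [[|[|[|//]]] lt3].
- by rewrite (_ : Ordinal lt3 = 0)//; exact/val_inj.
- by rewrite (_ : Ordinal lt3 = 1)//; exact/val_inj.
- by rewrite (_ : Ordinal lt3 = 2)//; exact/val_inj.
Qed.

Lemma sum3 (F : 'I_3 -> R) : \sum_(j < 3) F j = F 0 + F 1 + F 2.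
Proof.
rewrite !big_ord_recl big_ord0 addr0 addrA.
by congr (F _ + F _ + F _); exact/val_inj.
Qed.

(** * Dot and cross products *)

Definition dot x y : R := \sum_(j < 3) x j * y j.

Lemma dotC x y : dot x y = dot y x.
Proof. by apply: eq_bigr => i _; rewrite mulrC. Qed.

Lemma dot_combl (a b : R) x y z :
  dot (fun j => a * x j + b * y j) z = a * dot x z + b * dot y z.
Proof. by rewrite /dot !sum3; ring. Qed.

Lemma dot_scalel (a : R) x z : dot (fun j => a * x j) z = a * dot x z.
Proof. by rewrite /dot !sum3; ring. Qed.

Lemma dot_gt0 x : (exists i, x i != 0) -> 0 < dot x x.
Proof.
move=> [i xi]; rewrite /dot lt_def sumr_ge0 ?andbT; last by move=> j _; rewrite -expr2 sqr_ge0.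
apply: contra xi; rewrite psumr_eq0 => [/allP/(_ i)|j _]; last by rewrite -expr2 sqr_ge0.
by rewrite mem_index_enum /= -expr2 sqrf_eq0; exact.
Qed.

(** Addition in ['I_3] is modulo 3, so [j + 1] and [j + 2] are the other two indices in cyclic
    order. *)
Definition cross x y : 'I_3 -> R := fun j => x (j + 1) * y (j + 2) - x (j + 2) * y (j + 1).

Lemma cross3 x y : [/\ cross x y 0 = x 1 * y 2 - x 2 * y 1,
  cross x y 1 = x 2 * y 0 - x 0 * y 2 & cross x y 2 = x 0 * y 1 - x 1 * y 0].
Proof.
by rewrite /cross; split; congr (x _ * y _ - x _ * y _); exact/val_inj.
Qed.

Lemma dot_crossl x y : dot (cross x y) x = 0.
Proof. by rewrite /dot sum3; have [-> -> ->] := cross3 x y; ring. Qed.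

Lemma dot_crossr x y : dot (cross x y) y = 0.
Proof. by rewrite /dot sum3; have [-> -> ->] := cross3 x y; ring. Qed.

(** Lagrange's identity. *)
Lemma dot_cross x y : dot (cross x y) (cross x y) = dot x x * dot y y - dot x y ^+ 2.
Proof. by rewrite /dot !sum3; have [-> -> ->] := cross3 x y; ring. Qed.

(** * Orthogonal matrices given by rows, and diagonal sign matrices *)

Definition mx_rows x y z : 'M[R]_3 :=
  \matrix_(i < 3, j < 3) (if i == 0 then x j else if i == 1 then y j else z j).

Lemma mx_rows_orthogonal x y z : dot x x = 1 -> dot y y = 1 -> dot z z = 1 ->
  dot x y = 0 -> dot z x = 0 -> dot z y = 0 ->
  mx_rows x y z *m (mx_rows x y z)^T = 1%:M.
Proof.
move=> xx yy zz xy zx zy; apply/matrixP => i j.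
have yx : dot y x = 0 by rewrite dotC.
have xz : dot x z = 0 by rewrite dotC.
have yz : dot y z = 0 by rewrite dotC.
have r0 : mx_rows x y z 0 = x by apply/funext => k; rewrite mxE.
have r1 : mx_rows x y z 1 = y by apply/funext => k; rewrite mxE.
have r2 : mx_rows x y z 2 = z by apply/funext => k; rewrite mxE.
have -> : (mx_rows x y z *m (mx_rows x y z)^T) i j = dot (mx_rows x y z i) (mx_rows x y z j).
  by rewrite [LHS]mxE; apply: eq_bigr => k _; rewrite [_^T _ _]mxE.
rewrite mxE; elim/ord3_ind: i; elim/ord3_ind: j; by rewrite ?r0 ?r1 ?r2.
Qed.

Lemma orthogonal_det (A : 'M[R]_3) : A *m A^T = 1%:M -> \det A = 1 \/ \det A = -1.
Proof.
move=> /(congr1 determinant); rewrite det_mulmx det_tr det1 -expr2 => /eqP.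
by rewrite sqrf_eq1 => /orP[] /eqP; [left|right].
Qed.

Definition sign_mx (a b c : R) : 'M[R]_3 :=
  diag_mx (\row_(j < 3) (if j == 0 then a else if j == 1 then b else c)).

Lemma sign_mx_mul (a b c : R) (A : 'M[R]_3) i j :
  (sign_mx a b c *m A) i j = (if i == 0 then a else if i == 1 then b else c) * A i j.
Proof. by rewrite mul_diag_mx !mxE. Qed.

Lemma sign_mx_det (a b c : R) : \det (sign_mx a b c) = a * b * c.
Proof. by rewrite det_diag !big_ord_recl big_ord0 !mxE /= mulr1 mulrA. Qed.

Lemma sign_mx_orthogonal (a b c : R) (A : 'M[R]_3) : a ^+ 2 = 1 -> b ^+ 2 = 1 -> c ^+ 2 = 1 ->
  A *m A^T = 1%:M -> (sign_mx a b c *m A) *m (sign_mx a b c *m A)^T = 1%:M.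
Proof.
move=> a2 b2 c2 AA; rewrite trmx_mul mulmxA -(mulmxA _ A) AA mulmx1.
rewrite tr_diag_mx; apply/matrixP => i j; rewrite mul_diag_mx !mxE.
elim/ord3_ind: i; elim/ord3_ind: j; rewrite /= ?mulr0n ?mulr0 ?mulr1n -?expr2 //.
Qed.

(** Once [P] and [Q] are scaled to unit length, their difference and sum are orthogonal; normalised,
    they form the first two rows, and the cross product gives the third. The common ratio [a] for
    [P] and [Q] later produces the term [a * (u ^+ 2 + v ^+ 2)]. *)
Lemma frame_exists (P Q : 'I_3 -> R) :
  (forall a b : R, (forall i, a * P i + b * Q i = 0) -> a = 0 /\ b = 0) ->
  exists (A : 'M[R]_3) (lam mu a : R), [/\ SO3 A, [/\ 0 < lam, 0 < mu & 0 <= a],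
    [/\ \sum_(j < 3) A 0 j * P j = lam, \sum_(j < 3) A 1 j * P j = a * lam
      & \sum_(j < 3) A 2 j * P j = 0]
    & [/\ \sum_(j < 3) A 0 j * Q j = - mu, \sum_(j < 3) A 1 j * Q j = a * mu
      & \sum_(j < 3) A 2 j * Q j = 0]].
Proof.
move=> indep.
have comb_neq0 (a b : R) : a != 0 \/ b != 0 -> 0 < dot (fun j => a * P j + b * Q j) (fun j => a * P j + b * Q j).
  move=> ab; apply: dot_gt0; apply: contrapT => /forallNP H.
  have [i|a0 b0] := indep a b; first by have /negP := H i; rewrite negbK => /eqP.
  by case: ab; rewrite ?a0 ?b0 eqxx.
have PP : 0 < dot P P.
  have := comb_neq0 1 0 (or_introl (oner_neq0 _)); rewrite dot_combl dotC dot_combl; lra.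
have QQ : 0 < dot Q Q.
  have := comb_neq0 0 1 (or_intror (oner_neq0 _)); rewrite dot_combl [dot Q _]dotC dot_combl; lra.
pose n := Num.sqrt (dot P P); pose m := Num.sqrt (dot Q Q).
have n0 : 0 < n by rewrite sqrtr_gt0.
have m0 : 0 < m by rewrite sqrtr_gt0.
have nE : dot P P = n ^+ 2 by rewrite sqr_sqrtr// ltW.
have mE : dot Q Q = m ^+ 2 by rewrite sqr_sqrtr// ltW.
have n1 : n != 0 by rewrite gt_eqF.
have m1 : m != 0 by rewrite gt_eqF.
(* The cosine of the angle between [P] and [Q]. The difference and sum of the unit vectors have
   squared lengths [2 - 2 * c] and [2 + 2 * c], positive by independence. *)
pose c := dot P Q / (n * m).
have cE : dot P Q = c * (n * m) by rewrite divfK// mulf_neq0.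
have cE' : dot Q P = c * (n * m) by rewrite dotC.
have combE (a b : R) : dot (fun j => a * P j + b * Q j) (fun j => a * P j + b * Q j) =
    a ^+ 2 * n ^+ 2 + 2 * a * b * c * (n * m) + b ^+ 2 * m ^+ 2.
  by rewrite dot_combl ![dot _ (fun _ => _ + _)]dotC !dot_combl nE mE cE cE'; ring.
have c1 : 0 < 2 - 2 * c.
  have := comb_neq0 n^-1 (- m^-1); rewrite combE invr_eq0 n1.
  have -> : n^-1 ^+ 2 * n ^+ 2 + 2 * n^-1 * (- m^-1) * c * (n * m) + (- m^-1) ^+ 2 * m ^+ 2 = 2 - 2 * c.
    by field; rewrite n1 m1.
  by apply; left.
have c2 : 0 < 2 + 2 * c.
  have := comb_neq0 n^-1 m^-1; rewrite combE invr_eq0 n1.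
  have -> : n^-1 ^+ 2 * n ^+ 2 + 2 * n^-1 * m^-1 * c * (n * m) + m^-1 ^+ 2 * m ^+ 2 = 2 + 2 * c.
    by field; rewrite n1 m1.
  by apply; left.
pose d := Num.sqrt (2 - 2 * c); pose e := Num.sqrt (2 + 2 * c).
have d0 : 0 < d by rewrite sqrtr_gt0.
have e0 : 0 < e by rewrite sqrtr_gt0.
have d1 : d != 0 by rewrite gt_eqF.
have e1 : e != 0 by rewrite gt_eqF.
(* Expressing [c] through [d] or [e] makes the identities below rational, within reach of
   [field]. *)
have dE : c = 1 - d ^+ 2 / 2 by rewrite sqr_sqrtr ?ltW//; field.
have eE : c = e ^+ 2 / 2 - 1 by rewrite sqr_sqrtr ?ltW//; field.
pose X j := (d * n)^-1 * P j + - (d * m)^-1 * Q j.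
pose Y j := (e * n)^-1 * P j + (e * m)^-1 * Q j.
have ZZ : 0 < dot (cross P Q) (cross P Q).
  rewrite dot_cross nE mE cE.
  have -> : n ^+ 2 * m ^+ 2 - (c * (n * m)) ^+ 2 = (n * m) ^+ 2 * ((2 - 2 * c) * (2 + 2 * c)) / 4 by field.
  by rewrite !divr_gt0 ?mulr_gt0 ?exprn_gt0 ?mulr_gt0.
pose r := (Num.sqrt (dot (cross P Q) (cross P Q)))^-1.
pose Z0 j := r * cross P Q j.
have XP : dot X P = n * d / 2.
  by rewrite dot_combl nE cE' dE; field; rewrite d1 n1 m1.
have XQ : dot X Q = - (m * d / 2).
  by rewrite dot_combl mE cE dE; field; rewrite d1 n1 m1.
have YP : dot Y P = n * e / 2.
  by rewrite dot_combl nE cE' eE; field; rewrite e1 n1 m1.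
have YQ : dot Y Q = m * e / 2.
  by rewrite dot_combl mE cE eE; field; rewrite e1 n1 m1.
have ZP : dot Z0 P = 0 by rewrite dot_scalel dot_crossl mulr0.
have ZQ : dot Z0 Q = 0 by rewrite dot_scalel dot_crossr mulr0.
have XX : dot X X = 1.
  rewrite {1}/X dot_combl ![dot _ X]dotC XP XQ; field; by rewrite d1 n1 m1.
have YY : dot Y Y = 1.
  rewrite {1}/Y dot_combl ![dot _ Y]dotC YP YQ; field; by rewrite e1 n1 m1.
have XY : dot X Y = 0.
  rewrite {1}/X dot_combl ![dot _ Y]dotC YP YQ; field; by rewrite d1 n1 m1.
have ZX : dot Z0 X = 0 by rewrite dotC {1}/X dot_combl ![dot _ Z0]dotC ZP ZQ !mulr0 addr0.
have ZY : dot Z0 Y = 0 by rewrite dotC {1}/Y dot_combl ![dot _ Z0]dotC ZP ZQ !mulr0 addr0.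
have Z1 : dot Z0 Z0 = 1.
  rewrite dot_scalel dotC dot_scalel mulrA -expr2 /r exprVn sqr_sqrtr ?ltW// mulVf//.
  by rewrite gt_eqF.
have AA := mx_rows_orthogonal XX YY Z1 XY ZX ZY.
(* The third row is orthogonal to [P] and [Q], so its sign [w] is free to make the determinant 1.
   The ratio [e / d] is the cotangent of half the angle between [P] and [Q]. *)
have key (w : R) (A : 'M[R]_3) : (A = sign_mx 1 1 w *m mx_rows X Y Z0) -> SO3 A ->
  exists (A : 'M[R]_3) (lam mu a : R), [/\ SO3 A, [/\ 0 < lam, 0 < mu & 0 <= a],
    [/\ \sum_(j < 3) A 0 j * P j = lam, \sum_(j < 3) A 1 j * P j = a * lam
      & \sum_(j < 3) A 2 j * P j = 0]
    & [/\ \sum_(j < 3) A 0 j * Q j = - mu, \sum_(j < 3) A 1 j * Q j = a * mu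
      & \sum_(j < 3) A 2 j * Q j = 0]].
  move=> AE SOA; exists A, (n * d / 2), (m * d / 2), (e / d).
  have A0 (V : 'I_3 -> R) : \sum_(j < 3) A 0 j * V j = dot X V.
    by apply: eq_bigr => j _; rewrite AE sign_mx_mul mxE /= mul1r.
  have A1 (V : 'I_3 -> R) : \sum_(j < 3) A 1 j * V j = dot Y V.
    by apply: eq_bigr => j _; rewrite AE sign_mx_mul mxE /= mul1r.
  have A2 (V : 'I_3 -> R) : \sum_(j < 3) A 2 j * V j = w * dot Z0 V.
    by rewrite -dot_scalel; apply: eq_bigr => j _; rewrite AE sign_mx_mul mxE.
  split => //.
  - by split; rewrite ?divr_ge0 ?divr_gt0 ?mulr_gt0 ?ltW.
  - by rewrite A0 A1 A2 XP YP ZP mulr0; split => //; field.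
  - by rewrite A0 A1 A2 XQ YQ ZQ mulr0; split => //; field.
have [det1|detN1] := orthogonal_det AA.
  apply: (key 1 _ erefl); split; first by apply: sign_mx_orthogonal; rewrite ?expr1n.
  by rewrite det_mulmx sign_mx_det det1 !mulr1.
apply: (key (-1) _ erefl); split; first by apply: sign_mx_orthogonal; rewrite ?sqrrN ?expr1n.
by rewrite det_mulmx sign_mx_det detN1 !mul1r mulrNN mulr1.
Qed.

End Frame.

(** * The normal form *)

Section NormalForm.
Variable R : realType.
Local Notation S := (@smooth2_germ R).
Local Notation loc := (@loc R).

Lemma loc_forall3 (P : 'I_3 -> R -> R -> Prop) : (forall i, loc (P i)) ->
  loc (fun u v => forall i, P i u v).
Proof. by move=> H; apply: locS3 (H 0) (H 1) (H 2) => u v; exact: ord3_ind. Qed.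

Lemma pu_sum (c : 'I_3 -> R) (F : 'I_3 -> R -> R -> R) : (forall i, S (F i)) ->
  loc (fun u v => pu (fun x y => \sum_(j < 3) c j * F j x y) u v =
                  \sum_(j < 3) c j * pu (F j) u v).
Proof.
move=> SF; apply: locW (loc_forall3 (fun i => smooth_derive1 (SF i))) => u v D.
have D' := is_derive_sum (fun i => is_deriveZ (c i) (D i)).
by rewrite fct_sumE in D'; exact: (pu_val (f := fun x y => \sum_(j < 3) c j * F j x y) D').
Qed.

Lemma pv_sum (c : 'I_3 -> R) (F : 'I_3 -> R -> R -> R) : (forall i, S (F i)) ->
  loc (fun u v => pv (fun x y => \sum_(j < 3) c j * F j x y) u v =
                  \sum_(j < 3) c j * pv (F j) u v).
Proof.
move=> SF; apply: locW (loc_forall3 (fun i => smooth_derive2 (SF i))) => u v D.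
have D' := is_derive_sum (fun i => is_deriveZ (c i) (D i)).
by rewrite fct_sumE in D'; exact: (pv_val (f := fun x y => \sum_(j < 3) c j * F j x y) D').
Qed.

(** Hadamard's lemma on the axis splits off the constant terms of [al] and [be]. *)
Lemma split_form_taylor g al be ch : split_form g al be ch ->
  exists2 b : R -> R -> R, S b & exists2 b' : R -> R -> R, S b' &
    loc (fun u v => g u v = al 0 0 * u ^+ 2 + be 0 0 * v ^+ 2 + u ^+ 3 * b u 0
                      + u ^+ 2 * v ^+ 2 * ch u v + v ^+ 3 * b' v 0).
Proof.
move=> [Sa Sb Sc E].
have H (k : R -> R -> R) : S k ->
    exists2 b, S b & loc (fun u _ => k u 0 = k 0 0 + u * b u 0).
  move=> Sk; have [||b [Sb' Eb _]] := @hadamard _ (fun u _ => k u 0 - k 0 0).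
  - by apply: smooth_sub; [exact: smooth_axis1|exact: smooth_cst].
  - by apply: locT => _ v; rewrite subrr.
  by exists b => //; apply: locW (loc_axis1 Eb) => u _ <-; rewrite addrC subrK.
have [b Sb' Eb] := H _ Sa; have [b' Sb'' Eb'] := H _ Sb.
exists b => //; exists b' => //.
apply: locS3 E Eb (loc_swap Eb') => u v -> -> ->; ring.
Qed.

(** The normal form before the orientation of [s] and the signs of [c1] and [c3] at the origin are
    arranged, with one-variable germs still in the two-variable encoding. *)
Definition signed_normal_form (f : 'I_3 -> R -> R -> R) a (b1 b3 c1 c3 b2 c2 s1 s2 t1 t2 : R -> R -> R)
  (A : 'M[R]_3) := [/\ [/\ S b1, S b3, S c1 & S c3], S b2 /\ S c2,
    diffeo_germ s1 s2 t1 t2 /\ SO3 A, 0 <= a &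
    loc (fun u v => let g := fun i : 'I_3 => \sum_(j < 3) A i j * f j (t1 u v) (t2 u v) in
          [/\ g 0%R = u ^+ 2 - v ^+ 2,
              g 1%R = a * (u ^+ 2 + v ^+ 2) + u ^+ 3 * b1 u 0
                      + u ^+ 2 * v ^+ 2 * b2 u v + v ^+ 3 * b3 v 0
            & g 2%R = u ^+ 3 * c1 u 0 + u ^+ 2 * v ^+ 2 * c2 u v + v ^+ 3 * c3 v 0])].

Lemma signed_normal_form_exists (f : 'I_3 -> R -> R -> R) :
  (forall i, S (f i)) -> (forall i, f i 0 0 = 0) ->
  forall (h1 h2 k1 k2 : R -> R -> R) (phi1 phi2 : 'I_3 -> R -> R -> R),
  diffeo_germ h1 h2 k1 k2 ->
  (forall i, S (phi1 i)) -> (forall i, S (phi2 i)) ->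
  loc (fun u v => forall i,
    pu (fun x y => f i (k1 x y) (k2 x y)) u v = u * phi1 i u v /\
    pv (fun x y => f i (k1 x y) (k2 x y)) u v = v * phi2 i u v) ->
  (forall a b : R, (forall i, a * phi1 i 0 0 + b * phi2 i 0 0 = 0) -> a = 0 /\ b = 0) ->
  exists a b1 b3 c1 c3 b2 c2 s1 s2 t1 t2 A,
    signed_normal_form f a b1 b3 c1 c3 b2 c2 s1 s2 t1 t2 A.
Proof.
move=> Sf f0 h1 h2 k1 k2 phi1 phi2 D S1 S2 L indep.
have [A [lam [mu [a [SOA [lam0 mu0 a0] [P0 P1 P2] [Q0 Q1 Q2]]]]]] := frame_exists indep.
have [_ [K1 K2] [_ [k10 k20]] _ _] := D.
pose F i u v := f i (k1 u v) (k2 u v).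
have SF i : S (F i) by exact: smooth_comp.
have F0 i : F i 0 0 = 0 by rewrite /F k10 k20.
pose G i u v := \sum_(j < 3) A i j * F j u v.
have formG i : exists al be ch, [/\ split_form (G i) al be ch,
    al 0 0 = (\sum_(j < 3) A i j * phi1 j 0 0) / 2 &
    be 0 0 = (\sum_(j < 3) A i j * phi2 j 0 0) / 2].
  apply: (@split_form_of_partials _ _ (fun u v => \sum_(j < 3) A i j * phi1 j u v)
                                (fun u v => \sum_(j < 3) A i j * phi2 j u v)).
  - exact: smooth_sum.
  - exact: smooth_sum.
  - exact: smooth_sum.
  - by rewrite /G big1// => j _; rewrite F0 mulr0.
  - apply: locS2 L (pu_sum (A i) SF) => u v E ->; rewrite mulr_sumr.
    by apply: eq_bigr => j _; rewrite (E j).1 mulrCA.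
  - apply: locS2 L (pv_sum (A i) SF) => u v E ->; rewrite mulr_sumr.
    by apply: eq_bigr => j _; rewrite (E j).2 mulrCA.
have [al0 [be0 [ch0 [F0' a00 b00]]]] := formG 0.
have [al1 [be1 [ch1 [F1 a10 b10]]]] := formG 1.
have [al2 [be2 [ch2 [F2 a20 b20]]]] := formG 2.
have al0p : 0 < al0 0 0 by rewrite a00 P0 divr_gt0.
have be0n : be0 0 0 < 0 by rewrite b00 Q0; lra.
have [s1 [s2 [t1 [t2 [D' E0 H]]]]] := normalize_both F0' al0p be0n.
have [al1' [be1' [ch1' [F1' a1' b1']]]] := H _ _ _ _ F1.
have [al2' [be2' [ch2' [F2' a2' b2']]]] := H _ _ _ _ F2.
have [b1 Sb1 [b3 Sb3 E1]] := split_form_taylor F1'.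
have [c1 Sc1 [c3 Sc3 E2]] := split_form_taylor F2'.
have ln0 : lam != 0 by rewrite gt_eqF.
have mn0 : mu != 0 by rewrite gt_eqF.
(* The second component starts with coefficients [a * lam / 2] and [a * mu / 2]; dividing by
   [lam / 2] and [mu / 2] makes both equal to [a]. Those of the third component are zero. *)
have A1 : al1' 0 0 = a by rewrite a1' a10 a00 P0 P1; field.
have B1 : be1' 0 0 = a by rewrite b1' b10 b00 Q0 Q1; field.
have A2 : al2' 0 0 = 0 by rewrite a2' a20 P2 !mul0r.
have B2 : be2' 0 0 = 0 by rewrite b2' b20 Q2 !mul0r oppr0.
have [_ _ Sb2 _] := F1'; have [_ _ Sc2 _] := F2'.
exists a, b1, b3, c1, c3, ch1', ch2'; do 4 eexists; exists A; split => //.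
  by split; [exact: (diffeo_comp D D')|].
apply: locS3 E0 E1 E2 => u v e0 e1 e2; split; first exact: e0.
  rewrite [LHS]e1 A1 B1; ring.
rewrite [LHS]e2 A2 B2; ring.
Qed.

(** * Sign changes and exchange of the coordinates *)

Lemma diffeo_diag (a b : R) : a ^+ 2 = 1 -> b ^+ 2 = 1 ->
  diffeo_germ (fun u _ => a * u) (fun _ v => b * v) (fun u _ => a * u) (fun _ v => b * v).
Proof.
move=> a2 b2.
have Sa : S (fun u _ => a * u) by apply: smooth_mul; [exact: smooth_cst|exact: smooth_fst].
have Sb : S (fun _ v => b * v) by apply: smooth_mul; [exact: smooth_cst|exact: smooth_snd].
have E : loc (fun u v => a * (a * u) = u /\ b * (b * v) = v).
  by apply: locT => u v; rewrite !mulrA -!expr2 a2 b2 !mul1r.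
by split => //; rewrite !mulr0.
Qed.

Lemma jac_diag (a b : R) : jac (fun u _ : R => a * u) (fun _ v : R => b * v) = a * b.
Proof.
have Dm (c x : R) : is_derive x 1 (fun z : R => c * z) c.
  apply: (is_derive_eq (is_deriveZ c (is_derive_id x 1))); exact: mulr1.
have Dc (c x : R) : is_derive x 1 (fun _ : R => c) 0 by exact: is_derive_cst.
rewrite /jac (pu_val (f := fun u _ => a * u) (Dm a 0) erefl).
rewrite (pv_val (f := fun _ v => b * v) (Dm b 0) erefl).
rewrite (pv_val (f := fun u _ => a * u) (Dc (a * 0) 0) erefl).
by rewrite mul0r subr0.
Qed.

Lemma jac_swap : jac (fun _ y : R => y) (fun x _ : R => x) = -1.
Proof. by rewrite /jac pu_snd pv_snd pu_fst pv_fst mul0r mulr1 sub0r. Qed.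

Lemma sign_choice (x : R) : exists2 s : R, s ^+ 2 = 1 & 0 <= s * x.
Proof.
have [x0|x0] := leP 0 x; [exists 1|exists (-1)]; rewrite ?sqrrN ?expr1n ?mul1r//.
by rewrite mulN1r oppr_ge0 ltW.
Qed.

End NormalForm.

Unset Implicit Arguments.

Theorem theorem1 (R : realType) (f : 'I_3 -> R -> R -> R) :
  (forall i, smooth2_germ (f i)) ->
  (forall i, f i 0 0 = 0) ->
  (exists (h1 h2 k1 k2 : R -> R -> R) (phi1 phi2 : 'I_3 -> R -> R -> R),
     [/\ diffeo_germ h1 h2 k1 k2,
         (forall i, smooth2_germ (phi1 i)) /\ (forall i, smooth2_germ (phi2 i)),
         (exists2 e : R, 0 < e & forall u v, sq e (u, v) -> forall i,
            pu (fun x y => f i (k1 x y) (k2 x y)) u v = u * phi1 i u v /\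
            pv (fun x y => f i (k1 x y) (k2 x y)) u v = v * phi2 i u v)
       & (forall a b : R, (forall i, a * phi1 i 0 0 + b * phi2 i 0 0 = 0) ->
            a = 0 /\ b = 0)]) ->
  exists (a : R) (b1 b3 c1 c3 : R -> R) (b2 c2 : R -> R -> R)
         (s1 s2 t1 t2 : R -> R -> R) (A : 'M[R]_3),
    [/\ smooth1_germ b1 /\ smooth1_germ b3 /\ smooth1_germ c1 /\ smooth1_germ c3,
        smooth2_germ b2 /\ smooth2_germ c2,
        (diffeo_germ s1 s2 t1 t2 /\ orient_pres s1 s2) /\ SO3 A,
        (exists2 e : R, 0 < e & forall u v, sq e (u, v) ->
          let g := fun i : 'I_3 => \sum_(j < 3) A i j * f j (t1 u v) (t2 u v) in
          [/\ g 0%R = u ^+ 2 - v ^+ 2,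
              g 1%R = a * (u ^+ 2 + v ^+ 2) + u ^+ 3 * b1 u
                      + u ^+ 2 * v ^+ 2 * b2 u v + v ^+ 3 * b3 v
            & g 2%R = u ^+ 3 * c1 u + u ^+ 2 * v ^+ 2 * c2 u v + v ^+ 3 * c3 v])
      & [/\ 0 <= a, 0 <= c1 0 & 0 <= c3 0]].
Proof.
move=> Sf f0 [h1 [h2 [k1 [k2 [phi1 [phi2 [D [S1 S2] L indep]]]]]]].
have [a [b1 [b3 [c1 [c3 [b2 [c2 [s1 [s2 [t1 [t2 [A NF]]]]]]]]]]]] :=
  signed_normal_form_exists Sf f0 D S1 S2 L indep.
have [[Sb1 Sb3 Sc1 Sc3] [Sb2 Sc2] [Dst [AA detA]] a0 E] := NF.
have [[Ss1 Ss2] [St1 St2] [[s10 s20] [t10 t20]] _ _] := Dst.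
have [x x2 xc] := sign_choice (c1 0 0); have [y y2 yc] := sign_choice (c3 0 0).
have J0 := diffeo_jac_neq0 Dst.
have lin (e : R) k : smooth2_germ k -> smooth1_germ (fun u => e * k (e * u) 0).
  move=> Sk; apply: (smooth1_axis (f := fun u v => e * k (e * u) 0)).
  apply: smooth_mul; first exact: smooth_cst.
  apply: (smooth_comp Sk (g1 := fun u _ => e * u) (g2 := fun _ _ => 0)); rewrite ?mulr0//.
    by apply: smooth_mul; [exact: smooth_cst|exact: smooth_fst].
  exact: smooth_cst.
have lin2 (e e' : R) k : smooth2_germ k -> smooth2_germ (fun u v => k (e * u) (e' * v)).
  move=> Sk; apply: (smooth_comp Sk (g1 := fun u _ => e * u) (g2 := fun _ v => e' * v)); rewrite ?mulr0//.
    by apply: smooth_mul; [exact: smooth_cst|exact: smooth_fst].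
  by apply: smooth_mul; [exact: smooth_cst|exact: smooth_snd].
have cube (e w : R) : e ^+ 2 = 1 -> (e * w) ^+ 3 = e * w ^+ 3.
  by move=> e2; rewrite exprMn exprSr e2 mul1r.
have square (e w : R) : e ^+ 2 = 1 -> (e * w) ^+ 2 = w ^+ 2.
  by move=> e2; rewrite exprMn e2 mul1r.
have [Jp|Jn|/eqP] := ltgtP 0 (x * y * jac s1 s2).
- have DD := diffeo_diag x2 y2; have D1 := diffeo_comp Dst DD.
  exists a, (fun u => x * b1 (x * u) 0), (fun u => y * b3 (y * u) 0),
    (fun u => x * c1 (x * u) 0), (fun u => y * c3 (y * u) 0),
    (fun u v => b2 (x * u) (y * v)), (fun u v => c2 (x * u) (y * v)).
  do 4 eexists; exists A; split.
  + by do !split; exact: lin.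
  + by split; exact: lin2.
  + split; last by split.
    split; first exact: D1.
    have [[SD1 SD2] _ _ _ _] := DD.
    by rewrite /orient_pres -/(jac _ _) (jac_comp SD1 SD2 Ss1 Ss2 s10 s20) jac_diag.
  + have [[SD1 SD2] _ [[d1 d2] _] _ _] := DD.
    apply: locW (loc_comp SD1 SD2 d1 d2 E) => u v [e0 e1 e2] /=; split.
    * by rewrite e0 !square.
    * by rewrite e1 !square// !cube//; ring.
    * by rewrite e2 !square// !cube//; ring.
  + by split => //; rewrite mulr0.
- have nx2 : (- x) ^+ 2 = 1 by rewrite sqrrN.
  have ny2 : (- y) ^+ 2 = 1 by rewrite sqrrN.
  have DD := diffeo_diag nx2 ny2; have DS := diffeo_comp DD (@diffeo_swap R).
  have D1 := diffeo_comp Dst DS.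
  exists a, (fun u => - y * b3 (- y * u) 0), (fun u => - x * b1 (- x * u) 0),
    (fun u => y * c3 (- y * u) 0), (fun u => x * c1 (- x * u) 0),
    (fun u v => b2 (- x * v) (- y * u)), (fun u v => - c2 (- x * v) (- y * u)).
  do 4 eexists; exists (sign_mx (-1) 1 (-1) *m A); split.
  + have linN (e : R) k : smooth2_germ k -> smooth1_germ (fun u => e * k (- e * u) 0).
      move=> Sk; have := lin (- e) _ (smooth_opp Sk); congr smooth1_germ.
      by apply/funext => u; rewrite mulrNN.
    by do !split; [exact: lin|exact: lin|exact: linN|exact: linN].
  + split; first exact: (smooth_swap (lin2 _ _ _ Sb2)).
    exact/smooth_opp/(smooth_swap (lin2 _ _ _ Sc2)).
  + split; last first.
      split; first by apply: sign_mx_orthogonal; rewrite ?sqrrN ?expr1n.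
      by rewrite det_mulmx sign_mx_det detA; ring.
    split; first exact: D1.
    have [[SD1 SD2] _ [[d1 d2] _] _ _] := DD.
    have [[SS1 SS2] _ _ _ _] := DS.
    have [[SW1 SW2] _ _ _ _] := @diffeo_swap R.
    rewrite /orient_pres -/(jac _ _) (jac_comp SS1 SS2 Ss1 Ss2 s10 s20).
    rewrite (jac_comp SW1 SW2 SD1 SD2 d1 d2) jac_swap jac_diag mulrNN.
    by rewrite mulN1r mulNr oppr_gt0.
  + have [_ [SD1 SD2] [_ [d1 d2]] _ _] := DS.
    apply: locW (loc_comp SD1 SD2 d1 d2 E) => u v [e0 e1 e2] /=; split.
    * rewrite (eq_bigr (fun j => - (A 0 j * f j (t1 (- x * v) (- y * u)) (t2 (- x * v) (- y * u))))).
        by rewrite sumrN e0 !square// opprB.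
      by move=> j _; rewrite sign_mx_mul /= mulN1r mulNr.
    * rewrite (eq_bigr (fun j => (A 1 j * f j (t1 (- x * v) (- y * u)) (t2 (- x * v) (- y * u))))).
        by rewrite e1 !square// !cube//; ring.
      by move=> j _; rewrite sign_mx_mul /= mul1r.
    * rewrite (eq_bigr (fun j => - (A 2 j * f j (t1 (- x * v) (- y * u)) (t2 (- x * v) (- y * u))))).
        by rewrite sumrN e2 !square// !cube//; ring.
      by move=> j _; rewrite sign_mx_mul /= mulN1r mulNr.
  + by split => //; rewrite mulr0.
- have sn0 (s : R) : s ^+ 2 = 1 -> s != 0.
    by move=> ss; apply/eqP => s0; move/eqP: ss; rewrite s0 expr0n /= eq_sym oner_eq0.
  by rewrite eq_sym !mulf_eq0 (negPf J0) (negPf (sn0 _ x2)) (negPf (sn0 _ y2)).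
Qed.
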